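(* Let $\mathfrak{V}\subseteq\mathbb{D}_Q$ be a homogeneous subvariety of a nc operator ball. Then $\pi:\operatorname{Rep}^{cc}(A(\mathfrak{V}))\to\overline{\mathfrak{V}}$ given by $\pi(\Phi)=\Phi(Z)=(\Phi(Z_1),\dots,\Phi(Z_d))$ is a homeomorphism of $\operatorname{Rep}_n^{cc}(A(\mathfrak{V}))$ onto $\overline{\mathfrak{V}(n)}$ for every $n\in\mathbb{N}$, with inverse $X\mapsto\Phi_X$, where $\Phi_X(f)=f(X)$.
   Context: $M_n^d$ is the set of $d$-tuples of complex $n\times n$ matrices ($M_n=M_n^1$); $\mathbb{M}^d=\sqcup_{n\ge1}M_n^d$; for $\Omega\subseteq\mathbb{M}^d$, $\Omega(n)=\Omega\cap M_n^d$ and $\overline{\Omega}=\sqcup_n\overline{\Omega(n)}$ is the level-wise closure in $\mathbb{M}^d$. A nc function $f:\Omega\to\mathbb{M}^1$ on a set $\Omega$ closed under direct sums is a graded map ($X\in\Omega(n)\Rightarrow f(X)\in M_n$) with $f(X\oplus Y)=f(X)\oplus f(Y)$ and $f(S^{-1}XS)=S^{-1}f(X)S$ whenever $S\in GL_n$ and $X,S^{-1}XS\in\Omega(n)$. NC operator ball: given Hilbert spaces $\mathcal{R},\mathcal{S}$ and linearly independent $Q_1,\dots,Q_d\in\mathcal{L}(\mathcal{R},\mathcal{S})$, put $Q(X)=\sum_jQ_j\otimes X_j$ for $X\in\mathbb{M}^d$ and $\mathbb{D}_Q=\{X\in\mathbb{M}^d:\|Q(X)\|<1\}$. $H^\infty(\mathbb{D}_Q)$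 is the algebra of bounded nc functions $\mathbb{D}_Q\to\mathbb{M}^1$. A subvariety of $\mathbb{D}_Q$ is a set $\mathfrak{V}=\{X\in\mathbb{D}_Q: f(X)=0\ \forall f\in S\}$ with $S\subseteq H^\infty(\mathbb{D}_Q)$; it is homogeneous if $\lambda\mathfrak{V}\subseteq\mathfrak{V}$ for all $\lambda\in\mathbb{C}$, $|\lambda|\le1$. $H^\infty(\mathfrak{V})$ is the algebra of bounded nc functions on $\mathfrak{V}$ with norm $\|f\|=\sup_{X\in\mathfrak{V}}\|f(X)\|$ and matrix norms $\|[f_{jk}]\|=\sup_{X\in\mathfrak{V}}\|[f_{jk}(X)]\|$; $A(\mathfrak{V})$ is the norm closure in it of the restrictions to $\mathfrak{V}$ of free nc polynomials; its elements extend continuously to $\overline{\mathfrak{V}}$. $Z_1,\dots,Z_d$ are the coordinate functions. $\operatorname{Rep}^{cc}(A(\mathfrak{V}))=\sqcup_n\operatorname{Rep}_n^{cc}(A(\mathfrak{V}))$, where $\operatorname{Rep}_n^{cc}(A(\mathfrak{V}))$ is the space of completely contractive unital representations (homomorphisms) $A(\mathfrak{V})\to M_n$, with the topology of pointwise convergence. *)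

(* Defs.v *)
From HB Require Import structures.
From mathcomp Require Import all_boot all_order all_algebra.
From mathcomp Require Import sesquilinear complex.
From mathcomp Require Import all_classical all_reals all_analysis.
From mathcomp Require Import ring lra.
From mathcomp Require monalg.
(* The notations of monalg clash with those of MathComp-Analysis. *)
Import -(notations) monalg.

Set Implicit Arguments.
Unset Strict Implicit.
Unset Printing Implicit Defensive.

Import Order.TTheory GRing.Theory Num.Theory.
Import numFieldNormedType.Exports.

Local Open Scope classical_set_scope.
Local Open Scope ring_scope.

(* The complex numbers, typed as a numClosedFieldType so that the generic
   topology and norm of numeric fields apply to them. *)
Definition Cplx (R : realType) : numClosedFieldType := complex R.

HB.mixin Record NormedModule_isHilbert (C : numClosedFieldType) H
    of CompleteNormedModule C H := {
  hdot : {dot H for Num.conj};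
  hdotE : forall x : H, `|x| ^+ 2 = hdot x x
}.

#[short(type="hilbertType")]
HB.structure Definition Hilbert (C : numClosedFieldType) :=
  {H of CompleteNormedModule C H & NormedModule_isHilbert C H}.

Section OperatorNorm.
Context {R : realType}.
Local Notation C := (Cplx R).

(* Norms of a normedModType over [C] take values in [C]; they are real. *)
Definition rnorm {E : normedModType C} (x : E) : R := complex.Re `|x|.

(* The tensor product of [E] with the Hilbert space C^n is seen as [E^n]. *)
Definition l2norm {E : normedModType C} n (h : 'I_n -> E) : R :=
  Num.sqrt (\sum_k rnorm (h k) ^+ 2).

Definition opnorm {E F : normedModType C} m n
    (T : ('I_n -> E) -> ('I_m -> F)) : \bar R :=
  ereal_sup [set (l2norm (T h))%:E | h in [set h | l2norm h <= 1]].

Definition mxact m n (A : 'M[C]_(m, n)) (h : 'I_n -> C^o) : 'I_m -> C^o :=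
  fun i => \sum_k A i k * h k.

Definition mxnorm m n (A : 'M[C]_(m, n)) : \bar R := opnorm (mxact A).

Lemma rnormE (E : normedModType C) (x : E) : (rnorm x)%:C%C = `|x|.
Proof. by rewrite /rnorm RRe_real // realE normr_ge0. Qed.

Lemma rnorm_ge0 (E : normedModType C) (x : E) : 0 <= rnorm x.
Proof. by rewrite -lecR rnormE normr_ge0. Qed.

Lemma ler_rnormD (E : normedModType C) (x y : E) :
  rnorm (x + y) <= rnorm x + rnorm y.
Proof. by rewrite -lecR rmorphD /= !rnormE ler_normD. Qed.

Lemma rnormZ (E : normedModType C) (a : C) (x : E) :
  rnorm (a *: x) = rnorm (a : C^o) * rnorm x.
Proof. by apply: (@complexI R); rewrite rmorphM /= !rnormE normrZ. Qed.

Lemma rnorm0 (E : normedModType C) : rnorm (0 : E) = 0.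
Proof. by rewrite /rnorm normr0. Qed.

Lemma rnorm_eq0 (E : normedModType C) (x : E) : rnorm x = 0 -> x = 0.
Proof. by move=> h; apply/eqP; rewrite -normr_eq0 -rnormE h. Qed.

Lemma l2norm_ge0 (E : normedModType C) n (h : 'I_n -> E) : 0 <= l2norm h.
Proof. exact: sqrtr_ge0. Qed.

Lemma sqr_l2norm (E : normedModType C) n (h : 'I_n -> E) :
  l2norm h ^+ 2 = \sum_k rnorm (h k) ^+ 2.
Proof. by rewrite sqr_sqrtr // sumr_ge0 // => k _; rewrite sqr_ge0. Qed.

Lemma l2norm_le (E : normedModType C) n (h : 'I_n -> E) (c : R) : 0 <= c ->
  (l2norm h <= c) = (\sum_k rnorm (h k) ^+ 2 <= c ^+ 2).
Proof.
by move=> c0; rewrite -sqr_l2norm ler_pXn2r // nnegrE ?l2norm_ge0.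
Qed.

Lemma rnorm_le_l2norm (E : normedModType C) n (h : 'I_n -> E) k :
  rnorm (h k) <= l2norm h.
Proof.
rewrite -(@ler_pXn2r _ 2) ?nnegrE ?rnorm_ge0 ?l2norm_ge0 // sqr_l2norm.
rewrite (bigD1 k) //= lerDl sumr_ge0 // => i _; exact: sqr_ge0.
Qed.

Lemma sum_mul_le n (a b : 'I_n -> R) (A B : R) : 0 <= A -> 0 <= B ->
  \sum_k a k ^+ 2 = A ^+ 2 -> \sum_k b k ^+ 2 = B ^+ 2 ->
  \sum_k a k * b k <= A * B.
Proof.
move=> A0 B0 hA hB.
have [A00|An0] := eqVneq A 0.
  have h k : a k = 0.
    have /eqP := hA; rewrite A00 expr0n /= psumr_eq0; last first.
      by move=> i _; exact: sqr_ge0.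
    by move=> /allP /(_ k); rewrite mem_index_enum /= sqrf_eq0 => /(_ isT) /eqP.
  by rewrite A00 mul0r big1 // => k _; rewrite h mul0r.
have [B00|Bn0] := eqVneq B 0.
  have h k : b k = 0.
    have /eqP := hB; rewrite B00 expr0n /= psumr_eq0; last first.
      by move=> i _; exact: sqr_ge0.
    by move=> /allP /(_ k); rewrite mem_index_enum /= sqrf_eq0 => /(_ isT) /eqP.
  by rewrite B00 mulr0 big1 // => k _; rewrite h mulr0.
have : 0 <= \sum_k (B * a k - A * b k) ^+ 2.
  by apply: sumr_ge0 => k _; exact: sqr_ge0.
have -> : \sum_k (B * a k - A * b k) ^+ 2 =
    B ^+ 2 * (\sum_k a k ^+ 2) - 2 * A * B * (\sum_k a k * b k)
    + A ^+ 2 * (\sum_k b k ^+ 2).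
  rewrite !mulr_sumr -sumrB -big_split /=; apply: eq_bigr => k _; ring.
rewrite hA hB.
have AB : 0 < A * B by rewrite mulr_gt0 // lt_neqAle eq_sym ?An0 ?Bn0.
move=> h; rewrite -(ler_pM2l AB); nra.
Qed.

Lemma ler_l2normD (E : normedModType C) n (g h : 'I_n -> E) :
  l2norm (fun k => g k + h k) <= l2norm g + l2norm h.
Proof.
rewrite l2norm_le ?addr_ge0 ?l2norm_ge0 //.
apply: (@le_trans _ _ (\sum_k (rnorm (g k) + rnorm (h k)) ^+ 2)).
  apply: ler_sum => k _; rewrite ler_pXn2r ?nnegrE ?addr_ge0 ?rnorm_ge0 //.
  exact: ler_rnormD.
have -> : \sum_k (rnorm (g k) + rnorm (h k)) ^+ 2 =
    l2norm g ^+ 2 + 2 * (\sum_k rnorm (g k) * rnorm (h k)) + l2norm h ^+ 2.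
  rewrite !sqr_l2norm mulr_sumr -!big_split /=; apply: eq_bigr => k _; ring.
have := @sum_mul_le n (fun k => rnorm (g k)) (fun k => rnorm (h k)) _ _
  (l2norm_ge0 g) (l2norm_ge0 h) (esym (sqr_l2norm g)) (esym (sqr_l2norm h)).
by nra.
Qed.

Lemma l2normZ (E : normedModType C) n (a : C) (h : 'I_n -> E) :
  l2norm (fun k => a *: h k) = rnorm (a : C^o) * l2norm h.
Proof.
rewrite /l2norm -[X in X * _](ger0_norm (rnorm_ge0 _)) -sqrtr_sqr.
rewrite -sqrtrM ?sqr_ge0 //; congr Num.sqrt; rewrite mulr_sumr.
by apply: eq_bigr => k _; rewrite rnormZ exprMn.
Qed.

Lemma l2norm0 (E : normedModType C) n : l2norm (fun _ : 'I_n => 0 : E) = 0.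
Proof. by rewrite /l2norm big1 ?sqrtr0 // => k _; rewrite rnorm0 expr0n. Qed.

Lemma ler_l2norm_sum (E : normedModType C) n (I : Type) (r : seq I)
    (g : I -> 'I_n -> E) :
  l2norm (fun k => \sum_(i <- r) g i k) <= \sum_(i <- r) l2norm (g i).
Proof.
elim: r => [|i r IH].
  rewrite big_nil [X in l2norm X](_ : _ = fun=> 0) ?l2norm0 //.
  by apply/funext => k; rewrite big_nil.
rewrite big_cons.
have -> : (fun k => \sum_(j <- i :: r) g j k) =
    (fun k => g i k + (fun k => \sum_(j <- r) g j k) k).
  by apply/funext => k; rewrite big_cons.
by apply: le_trans (ler_l2normD _ _) _; rewrite lerD2l.
Qed.

Lemma l2norm_eq0 (E : normedModType C) n (h : 'I_n -> E) :
  l2norm h = 0 -> h = fun=> 0.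
Proof.
move=> h0; apply/funext => k; apply: rnorm_eq0; apply/eqP.
by rewrite eq_le rnorm_ge0 andbT -h0 rnorm_le_l2norm.
Qed.

Lemma opnormP (E F : normedModType C) m n (T : ('I_n -> E) -> ('I_m -> F))
    (c : R) : 0 <= c ->
  (forall (a : C) h, T (fun k => a *: h k) = fun i => a *: T h i) ->
  (opnorm T <= c%:E)%E <-> forall h, l2norm (T h) <= c * l2norm h.
Proof.
move=> c0 TZ; split; last first.
  move=> H; apply: ge_ereal_sup => _ [h /= h1 <-]; rewrite lee_fin.
  by apply: le_trans (H h) _; rewrite ler_piMr.
move=> H h; have [h0|hn0] := eqVneq (l2norm h) 0.
  have h00 := l2norm_eq0 h0.
  have -> : T h = fun=> 0.
    have -> : h = fun k => (0 : C) *: h k.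
      by rewrite {1}h00; apply/funext => k; rewrite scale0r.
    by rewrite TZ; apply/funext => i; rewrite scale0r.
  by rewrite l2norm0 h0 mulr0.
have hp : 0 < l2norm h by rewrite lt_neqAle eq_sym hn0 l2norm_ge0.
set a : C := ((l2norm h)^-1)%:C%C.
have ra : rnorm (a : C^o) = (l2norm h)^-1.
  rewrite /rnorm ger0_norm // /a.
  by rewrite -[0]/(0%:C%C) lecR invr_ge0 ltW.
have : ((l2norm (T (fun k => a *: h k)))%:E <= c%:E)%E.
  apply: le_trans H; apply: ereal_sup_ubound.
  by exists (fun k => a *: h k) => //=; rewrite l2normZ ra mulVf.
rewrite lee_fin TZ l2normZ ra ler_pdivrMl //.
by rewrite mulrC.
Qed.

Lemma mxactZ m n (A : 'M[C]_(m, n)) (a : C) h :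
  mxact A (fun k => a *: h k) = fun i => a *: mxact A h i.
Proof.
apply/funext => i; rewrite /mxact scaler_sumr; apply: eq_bigr => k _.
by rewrite -![_ *: _]/(_ * _) mulrCA.
Qed.

Lemma mxnormP m n (A : 'M[C]_(m, n)) (c : R) : 0 <= c ->
  (mxnorm A <= c%:E)%E <-> forall h, l2norm (mxact A h) <= c * l2norm h.
Proof. by move=> c0; apply: opnormP => // a h; exact: mxactZ. Qed.

Lemma mxactM m n p (A : 'M[C]_(m, n)) (B : 'M[C]_(n, p)) h :
  mxact (A *m B) h = mxact A (mxact B h).
Proof.
apply/funext => i; rewrite /mxact; under eq_bigr do rewrite mxE mulr_suml.
rewrite exchange_big /=; apply: eq_bigr => k _.
by rewrite mulr_sumr; apply: eq_bigr => l _; rewrite mulrA.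
Qed.

Lemma mxactD m n (A B : 'M[C]_(m, n)) h :
  mxact (A + B) h = fun i => mxact A h i + mxact B h i.
Proof.
apply/funext => i; rewrite /mxact -big_split /=.
by apply: eq_bigr => k _; rewrite mxE mulrDl.
Qed.

Lemma mxactZl m n (a : C) (A : 'M[C]_(m, n)) h :
  mxact (a *: A) h = fun i => a *: mxact A h i.
Proof.
apply/funext => i; rewrite /mxact scaler_sumr; apply: eq_bigr => k _.
by rewrite mxE -![_ *: _]/(_ * _) mulrA.
Qed.

Lemma mxact1 n h : mxact (1%:M : 'M[C]_n) h = h.
Proof.
apply/funext => i; rewrite /mxact (bigD1 i) //= mxE eqxx mul1r big1 ?addr0 //.
by move=> k /negbTE ki; rewrite mxE eq_sym ki mul0r.
Qed.

Lemma mxact0 m n h : mxact (0 : 'M[C]_(m, n)) h = fun=> 0.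
Proof.
by apply/funext => i; rewrite /mxact big1 // => k _; rewrite mxE mul0r.
Qed.

End OperatorNorm.

Section NCFunctions.
Context {R : realType} {d : nat}.
Local Notation C := (Cplx R).

(* Level [n] consists of matrices of size [n.+1]: sizes are at least 1. *)
Definition mxtuple (n : nat) : Type := {ptws 'I_d -> 'M[C]_n.+1}.
HB.instance Definition _ n := Topological.on (mxtuple n).

Definition nc_set : Type := forall n, set (mxtuple n).

Definition mxdsum m n (A : 'M[C]_m.+1) (B : 'M[C]_n.+1) :
    'M[C]_((m + n.+1).+1) := block_mx A 0 0 B.

(* Here [Omega n] is the subtype: elements are only defined on [Omega]. *)
Definition graded (Omega : nc_set) : Type := forall n, Omega n -> 'M[C]_n.+1.

Section GradedAlgebra.
Variable Omega : nc_set.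
Local Notation G := (graded Omega).

HB.instance Definition _ := gen_eqMixin G.
HB.instance Definition _ := gen_choiceMixin G.

Lemma gradedP (f g : G) : (forall n X, f n X = g n X) -> f = g.
Proof. by move=> h; apply: functional_extensionality_dep => n; apply/funext. Qed.

Let g0 : G := fun n _ => 0.
Let g1 : G := fun n _ => 1.
Let gopp (f : G) : G := fun n X => - f n X.
Let gadd (f g : G) : G := fun n X => f n X + g n X.
Let gmul (f g : G) : G := fun n X => f n X * g n X.
Let gscale (a : C) (f : G) : G := fun n X => a *: f n X.

Let gaddA : associative gadd.
Proof. by move=> f g h; apply: gradedP => n X; exact: addrA. Qed.
Let gaddC : commutative gadd.
Proof. by move=> f g; apply: gradedP => n X; exact: addrC. Qed.
Let gadd0 : left_id g0 gadd.
Proof. by move=> f; apply: gradedP => n X; exact: add0r. Qed.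
Let gaddN : left_inverse g0 gopp gadd.
Proof. by move=> f; apply: gradedP => n X; exact: addNr. Qed.
HB.instance Definition _ := GRing.isZmodule.Build G gaddA gaddC gadd0 gaddN.

Let gmulA : associative gmul.
Proof. by move=> f g h; apply: gradedP => n X; exact: mulrA. Qed.
Let gmul1l : left_id g1 gmul.
Proof. by move=> f; apply: gradedP => n X; exact: mul1r. Qed.
Let gmul1r : right_id g1 gmul.
Proof. by move=> f; apply: gradedP => n X; exact: mulr1. Qed.
Let gmulDl : left_distributive gmul gadd.
Proof. by move=> f g h; apply: gradedP => n X; exact: mulrDl. Qed.
Let gmulDr : right_distributive gmul gadd.
Proof. by move=> f g h; apply: gradedP => n X; exact: mulrDr. Qed.
HB.instance Definition _ :=
  GRing.Zmodule_isPzRing.Build G gmulA gmul1l gmul1r gmulDl gmulDr.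

Let gscaleA a b f : gscale a (gscale b f) = gscale (a * b) f.
Proof. by apply: gradedP => n X; exact: scalerA. Qed.
Let gscale1 : left_id 1 gscale.
Proof. by move=> f; apply: gradedP => n X; exact: scale1r. Qed.
Let gscaleDr : right_distributive gscale +%R.
Proof. by move=> a f g; apply: gradedP => n X; exact: scalerDr. Qed.
Let gscaleDl f : {morph gscale^~ f : a b / a + b}.
Proof. by move=> a b; apply: gradedP => n X; exact: scalerDl. Qed.
HB.instance Definition _ := GRing.Zmodule_isLmodule.Build C G
  gscaleA gscale1 gscaleDr gscaleDl.

End GradedAlgebra.

(* [Z] stands for [X (+) Y] as an element of [Omega], so that no proof that
   [Omega] is closed under direct sums is needed. *)
Definition nc_fun (Omega : nc_set) (f : graded Omega) : Prop :=
  (forall m n (X : Omega m) (Y : Omega n) (Z : Omega (m + n.+1)%N),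
     (forall j, \val Z j = mxdsum (\val X j) (\val Y j)) ->
     f _ Z = mxdsum (f _ X) (f _ Y)) /\
  (forall n (X Y : Omega n) (S : 'M[C]_n.+1), S \in unitmx ->
     (forall j, \val Y j = invmx S *m \val X j *m S) ->
     f _ Y = invmx S *m f _ X *m S).

(* The supremum is taken in [0, +oo], so that it is 0 if [Omega] is empty. *)
Definition sup_mxnorm (Omega : nc_set) m (F : 'M[graded Omega]_m) : \bar R :=
  ereal_sup ([set 0%E] `|` [set x | exists n (X : Omega n),
    x = mxnorm (\mxblock_(j < m, k < m) F j k n X)]).

Definition sup_norm (Omega : nc_set) (f : graded Omega) : \bar R :=
  ereal_sup ([set 0%E] `|` [set x | exists n (X : Omega n),
    x = mxnorm (f n X)]).

Definition Hinf (Omega : nc_set) : set (graded Omega) :=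
  [set f | nc_fun f /\ (sup_norm f < +oo)%E].

Definition freepoly := malg (fmonom 'I_d) C.

Definition wordval n (X : mxtuple n) (w : fmonom 'I_d) : 'M[C]_n.+1 :=
  \prod_(j <- (w : seq 'I_d)) X j.

Definition polyval n (p : freepoly) (X : mxtuple n) : 'M[C]_n.+1 :=
  mmap scalar_mx (wordval X) p.

Definition polyres (Omega : nc_set) (p : freepoly) : graded Omega :=
  fun n X => polyval p (\val X).
Arguments polyres Omega p n X : clear implicits.

Definition A_set (V : nc_set) : set (graded V) :=
  [set f | Hinf f /\ forall e : R, 0 < e ->
     exists p : freepoly, (sup_norm (f - polyres V p)%R < e%:E)%E].

Lemma sup_normP (V : nc_set) (f : graded V) (c : R) : 0 <= c ->
  (sup_norm f <= c%:E)%E <->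
  forall n (X : V n) h, l2norm (mxact (f n X) h) <= c * l2norm h.
Proof.
move=> c0; split=> [H n X|H].
  apply/mxnormP => //; apply: le_trans H; apply: ereal_sup_ubound.
  by right; exists n, X.
apply: ge_ereal_sup => x [->|[n [X ->]]]; first by rewrite lee_fin.
by apply/mxnormP.
Qed.

Lemma sup_norm_fin (V : nc_set) (f : graded V) : (sup_norm f < +oo)%E <->
  exists2 c : R, 0 <= c &
    forall n (X : V n) h, l2norm (mxact (f n X) h) <= c * l2norm h.
Proof.
split=> [H|[c c0 /sup_normP H]]; last first.
  by apply: le_lt_trans (H c0) _; rewrite ltry.
have s0 : (0%E <= sup_norm f)%E by apply: ereal_sup_ubound; left.
have fs : sup_norm f \is a fin_num.
  by rewrite fin_numE gt_eqF ?lt_eqF //; apply: lt_le_trans s0; rewrite ltNyr.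
exists (fine (sup_norm f)); first exact: fine_ge0.
by apply/sup_normP; rewrite ?fine_ge0 // fineK.
Qed.

Lemma A_setP (V : nc_set) (f : graded V) : A_set f <->
  [/\ nc_fun f, (exists2 c : R, 0 <= c &
        forall n (X : V n) h, l2norm (mxact (f n X) h) <= c * l2norm h) &
    forall e : R, 0 < e -> exists p : freepoly, forall n (X : V n) h,
      l2norm (mxact (f n X - polyval p (\val X)) h) <= e * l2norm h].
Proof.
split=> [[[f1 /sup_norm_fin f2] f3]|[f1 f2 f3]].
  split=> // e e0; have [p /ltW hp] := f3 e e0; exists p.
  exact: (sup_normP _ (ltW e0)).1 hp.
split; first by split=> //; apply/sup_norm_fin.
move=> e e0; have [|p hp] := f3 (e / 2); first by rewrite divr_gt0.
exists p; apply: (@le_lt_trans _ _ (e / 2)%:E).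
  by apply/sup_normP => //; rewrite ltW ?divr_gt0.
by rewrite lte_fin ltr_pdivrMr // ltr_pMr // ltr1n.
Qed.

End NCFunctions.

Section AlgebraA.
Context {R : realType} {d : nat}.
Local Notation C := (Cplx R).

Lemma wordval_mmorphism n (X : @mxtuple R d n) : mmorphism (wordval X).
Proof.
split; last by rewrite /wordval fm1 big_nil.
by move=> u v; rewrite /wordval fmM big_cat.
Qed.
HB.instance Definition _ n (X : @mxtuple R d n) :=
  isMultiplicative.Build _ _ (wordval X) (wordval_mmorphism X).

Lemma polyval1 n (X : @mxtuple R d n) : polyval 1 X = 1.
Proof. by rewrite /polyval mmap1. Qed.

Lemma polyvalP n (X : @mxtuple R d n) a p q :
  polyval (a *: p + q) X = a *: polyval p X + polyval q X.
Proof. by rewrite /polyval mmapD mmapZ -mul_scalar_mx. Qed.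

Lemma polyvalM n (X : @mxtuple R d n) p q :
  polyval (p * q) X = polyval p X * polyval q X.
Proof.
rewrite /polyval; apply: (commr_mmap_is_multiplicative _).1 => g m m'.
exact: (esym (scalar_mxC _ _)).
Qed.

Lemma polyvalU n (X : @mxtuple R d n) j :
  polyval (mkmalgU (fmu j) 1) X = X j.
Proof. by rewrite /polyval mmapU mul1r /wordval fmU big_seq1. Qed.

Lemma mxdsumP m n (a : C) (A A' : 'M[C]_m.+1) (B B' : 'M[C]_n.+1) :
  a *: mxdsum A B + mxdsum A' B' = mxdsum (a *: A + A') (a *: B + B').
Proof.
have : a *: (block_mx A 0 0 B : 'M[C]_(m.+1 + n.+1)) + block_mx A' 0 0 B' =
    block_mx (a *: A + A') 0 0 (a *: B + B').
  by rewrite scale_block_mx add_block_mx !scaler0 !addr0.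
exact.
Qed.

Lemma mxdsumM m n (A A' : 'M[C]_m.+1) (B B' : 'M[C]_n.+1) :
  mxdsum A B *m mxdsum A' B' = mxdsum (A *m A') (B *m B').
Proof.
have : (block_mx A 0 0 B : 'M[C]_(m.+1 + n.+1)) *m block_mx A' 0 0 B' =
    block_mx (A *m A') 0 0 (B *m B').
  by rewrite mulmx_block !mulmx0 !mul0mx !addr0 !add0r.
exact.
Qed.

Variable V : @nc_set R d.

Lemma A_set1 : A_set (1 : graded V).
Proof.
apply/A_setP; split.
- split=> [m n X Y Z _|n X Y S Su _]; first exact: (@scalar_mx_block _ m.+1 n.+1 1).
  by rewrite -[LHS]/(1%:M) -[_ n X]/(1%:M) mulmx1 mulVmx.
- by exists 1 => // n X h; rewrite -[_ n X]/(1%:M) mxact1 mul1r.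
- move=> e e0; exists 1 => n X h; rewrite polyval1 subrr mxact0 l2norm0.
  by rewrite mulr_ge0 ?l2norm_ge0 // ltW.
Qed.

Lemma A_setP_lin (a : C) (f g : graded V) :
  A_set f -> A_set g -> A_set (a *: f + g).
Proof.
move=> /A_setP[[f1 f2] [b b0 fb] fa] /A_setP[[g1 g2] [c c0 gc] ga].
have key n (F G : 'M[C]_n.+1) h (x y : R) :
    l2norm (mxact F h) <= x * l2norm h -> l2norm (mxact G h) <= y * l2norm h ->
    l2norm (mxact (a *: F + G) h) <=
      (rnorm (a : C^o) * x + y) * l2norm h.
  move=> hF hG; rewrite mxactD mxactZl.
  apply: le_trans (ler_l2normD _ _) _; rewrite l2normZ mulrDl -mulrA.
  by rewrite lerD // ler_wpM2l ?rnorm_ge0.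
apply/A_setP; split.
- split=> [m n X Y Z hZ|n X Y S Su hY].
    rewrite -[LHS]/(a *: f _ Z + g _ Z) (f1 _ _ _ _ _ hZ) (g1 _ _ _ _ _ hZ).
    exact: mxdsumP.
  rewrite -[LHS]/(a *: f _ Y + g _ Y) (f2 _ _ _ _ Su hY) (g2 _ _ _ _ Su hY).
  by rewrite -[(a *: f + g) n X]/(a *: f _ X + g _ X) mulmxDr mulmxDl -scalemxAr -scalemxAl.
- exists (rnorm (a : C^o) * b + c); first by rewrite addr_ge0 ?mulr_ge0 ?rnorm_ge0.
  by move=> n X h; apply: key.
- move=> e e0; set r := rnorm (a : C^o).
  have r0 : 0 <= r by exact: rnorm_ge0.
  have [|p hp] := fa (e / (r + 1)).
    by rewrite divr_gt0 // ltr_wpDl.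
  have [|q hq] := ga (e / (r + 1)).
    by rewrite divr_gt0 // ltr_wpDl.
  exists (a *: p + q) => n X h; rewrite polyvalP.
  have -> : (a *: f + g) n X - (a *: polyval p (\val X) + polyval q (\val X)) =
      a *: (f n X - polyval p (\val X)) + (g n X - polyval q (\val X)).
    by rewrite scalerBr opprD addrACA.
  have -> : e = r * (e / (r + 1)) + e / (r + 1).
    by field; rewrite gt_eqF // ltr_wpDl.
  exact: key.
Qed.

Lemma A_setM (f g : graded V) : A_set f -> A_set g -> A_set (f * g).
Proof.
move=> /A_setP[[f1 f2] [b b0 fb] fa] /A_setP[[g1 g2] [c c0 gc] ga].
have key n (F G : 'M[C]_n.+1) h (x y : R) : 0 <= x ->
    (forall h, l2norm (mxact F h) <= x * l2norm h) ->
    l2norm (mxact G h) <= y * l2norm h ->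
    l2norm (mxact (F * G) h) <= x * y * l2norm h.
  move=> x0 hF hG; rewrite [mxact _ _]mxactM; apply: le_trans (hF _) _.
  by rewrite -mulrA ler_wpM2l.
apply/A_setP; split.
- split=> [m n X Y Z hZ|n X Y S Su hY].
    rewrite -[LHS]/(f _ Z *m g _ Z) (f1 _ _ _ _ _ hZ) (g1 _ _ _ _ _ hZ).
    exact: mxdsumM.
  rewrite -[LHS]/(f _ Y *m g _ Y) (f2 _ _ _ _ Su hY) (g2 _ _ _ _ Su hY).
  by rewrite -[(f * g) n X]/(f _ X *m g _ X) !mulmxA mulmxK.
- by exists (b * c); [rewrite mulr_ge0|move=> n X h; apply: key].
- move=> e e0.
  pose s := Num.min 1 (e / (b + c + 2)).
  have bc2 : 0 < b + c + 2 by rewrite ltr_wpDl // addr_ge0.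
  have s0 : 0 < s by rewrite lt_min ltr01 divr_gt0.
  have s1 : s <= 1 by rewrite ge_min lexx.
  have se : s * (b + c + 2) <= e by rewrite -ler_pdivlMr // ge_min lexx orbT.
  have [p hp] := fa s s0; have [q hq] := ga s s0.
  exists (p * q) => n X h; rewrite polyvalM.
  set P := polyval p (\val X); set Q := polyval q (\val X).
  have -> : (f * g) n X - P * Q = f n X * (g n X - Q) + (f n X - P) * Q.
    by rewrite mulrBr mulrBl addrA subrK.
  have hQ : l2norm (mxact Q h) <= (c + s) * l2norm h.
    have -> : Q = g n X + (-1) *: (g n X - Q).
      by rewrite scaleN1r opprB addrC subrK.
    rewrite mxactD mxactZl; apply: le_trans (ler_l2normD _ _) _.
    rewrite l2normZ mulrDl lerD // (_ : rnorm _ = 1) ?mul1r //.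
    by rewrite /rnorm normrN1.
  rewrite mxactD; apply: le_trans (ler_l2normD _ _) _.
  apply: (@le_trans _ _ (b * s * l2norm h + s * (c + s) * l2norm h)).
    by apply: lerD; apply: key => //; rewrite ltW.
  by rewrite -mulrDl ler_wpM2r ?l2norm_ge0 //; nra.
Qed.

Lemma A_set_submod : GRing.submod_closed (mem (@A_set R d V)).
Proof.
have A0 : A_set (0 : graded V).
  by rewrite -(subrr (1 : graded V)) addrC -scaleN1r; apply: A_setP_lin; exact: A_set1.
split; first exact: mem_set.
by move=> a f g /set_mem Af /set_mem Ag; apply: mem_set; exact: A_setP_lin.
Qed.

Lemma A_set_subring : GRing.subring_closed (mem (@A_set R d V)).
Proof.
split; first by apply: mem_set; exact: A_set1.
  move=> f g /set_mem Af /set_mem Ag; apply: mem_set.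
  by rewrite addrC -scaleN1r; exact: A_setP_lin.
by move=> f g /set_mem Af /set_mem Ag; apply: mem_set; exact: A_setM.
Qed.

Definition A_alg : Type := {f : graded V | f \in A_set (V := V)}.

HB.instance Definition _ := SubChoice.on A_alg.
HB.instance Definition _ := GRing.SubChoice_isSubPzRing.Build
  (graded V) (mem (@A_set R d V)) A_alg A_set_subring.
HB.instance Definition _ := GRing.SubZmodule_isSubLmodule.Build
  C (graded V) (mem (@A_set R d V)) A_alg (GRing.submod_closed_semi A_set_submod).
End AlgebraA.

Arguments mxtuple R d n : clear implicits.
Arguments nc_set R d : clear implicits.
Arguments freepoly R d : clear implicits.

Lemma rank_lt_ker (F : fieldType) d (A B : 'M[F]_d) (v : 'rV[F]_d) :
  (forall w : 'rV[F]_d, w *m A = 0 -> w *m B = 0) ->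
  v *m B = 0 -> v *m A <> 0 -> (\rank B < \rank A)%N.
Proof.
move=> hAB vB vA; have : (kermx A < kermx B)%MS.
  rewrite ltmxE; apply/andP; split.
    by apply/rV_subP => w /sub_kermxP wA; apply/sub_kermxP/hAB.
  apply/negP => kBA; apply: vA; apply/sub_kermxP; apply: submx_trans kBA.
  exact/sub_kermxP.
move=> /rank_ltmx; rewrite !mxrank_ker ltnNge => h.
by rewrite ltnNge; apply: contraNN h; exact: leq_sub2l.
Qed.

Section OperatorBall.
Context {R : realType} {d : nat} {H K : hilbertType (Cplx R)}.
Local Notation C := (Cplx R).
Variable Q : 'I_d -> {linear H -> K}.

Definition lin_indep : Prop :=
  forall c : 'I_d -> C, (forall x, \sum_j c j *: Q j x = 0) ->
    forall j, c j = 0.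

(* [Q(X) = \sum_j Q_j (x) X_j], from [H (x) C^(n+1)] to [K (x) C^(n+1)]. *)
Definition tensor_eval n (X : mxtuple R d n) (h : 'I_n.+1 -> H) :
    'I_n.+1 -> K := fun i => \sum_j \sum_k X j i k *: Q j (h k).

Definition op_ball : nc_set R d :=
  fun n => [set X | (opnorm (tensor_eval X) < 1)%E].
Arguments op_ball n _ : clear implicits.

Definition subvariety (V : nc_set R d) : Prop :=
  exists2 S : set (graded op_ball), S `<=` @Hinf R d op_ball &
    forall n, V n = [set \val X | X in
      [set X : op_ball n | forall f, S f -> f n X = 0]].

Let gram (xs : seq H) : 'M[C]_d :=
  \matrix_(j, k) \sum_(x <- xs) hdot (Q j x) (Q k x).

Let hdot_sqr (F : hilbertType C) (y : F) : hdot y y = ((rnorm y) ^+ 2)%:C%C.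
Proof. by rewrite rmorphXn /= rnormE hdotE. Qed.

Let hdot_le (F : hilbertType C) (x y : F) :
  rnorm (hdot x y : C^o) <= rnorm y * rnorm x.
Proof.
have [->|y0] := eqVneq y 0; first by rewrite linear0r !rnorm0 mul0r.
have yp : 0 < hdot y y by rewrite neq0_dnorm_gt0.
set a := hdot x y; pose z := x - (a / hdot y y) *: y.
have zy : hdot z y = 0.
  by rewrite linearBl /= linearZl_LR divfK ?subrr // gt_eqF.
have hx : hdot x x = hdot z z + `|a / hdot y y| ^+ 2 * hdot y y.
  rewrite -dnormZ -hnormDd; first by rewrite subrK.
  by rewrite linearZr_LR /= zy mulr0.
have : `|a| ^+ 2 <= (`|y| * `|x|) ^+ 2.
  rewrite exprMn !hdotE hx mulrDr ler_wpDl //; last first.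
    rewrite normrM normfV (ger0_norm (ltW yp)) exprMn exprVn.
    by rewrite mulrCA -mulrA [X in _ * X](_ : _ = 1) ?mulr1 //;
      field; rewrite gt_eqF.
  by rewrite mulr_ge0 // -hdotE exprn_ge0.
rewrite ler_pXn2r ?nnegrE ?mulr_ge0 // => h.
by rewrite -lecR rmorphM /= !rnormE.
Qed.

Let comb (v : 'I_d -> C) (x : H) : K := \sum_j v j *: Q j x.

Let comb_gram (v : 'I_d -> C) xs k :
  \sum_j v j * gram xs j k = \sum_(x <- xs) hdot (comb v x) (Q k x).
Proof.
under eq_bigr do rewrite mxE mulr_sumr.
rewrite exchange_big /=; apply: eq_bigr => x _.
rewrite /comb linear_sumlz /=; apply: eq_bigr => j _.
by rewrite linearZl_LR.
Qed.

Let gram_ker xs (v : 'rV[C]_d) : v *m gram xs = 0 <->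
  forall x, x \in xs -> comb (v 0) x = 0.
Proof.
have E k : (v *m gram xs) 0 k = \sum_(x <- xs) hdot (comb (v 0) x) (Q k x).
  by rewrite mxE comb_gram.
split=> [G0|G0]; last first.
  apply/rowP => k; rewrite E mxE big_seq big1 // => x /G0 ->.
  by rewrite linear0l.
have : \sum_(x <- xs) hdot (comb (v 0) x) (comb (v 0) x) = 0.
  transitivity (\sum_k Num.conj (v 0 k) * (v *m gram xs) 0 k).
    under [RHS]eq_bigr do rewrite E mulr_sumr.
    rewrite exchange_big /=; apply: eq_bigr => x _.
    rewrite {2}/comb linear_sumr /=; apply: eq_bigr => k _.
    by rewrite linearZr_LR.
  by rewrite G0 big1 // => k _; rewrite mxE mulr0.
move=> /eqP; rewrite psumr_eq0 => [/allP S0 x /S0 /=|x _].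
  by rewrite -hdotE expf_eq0 /= normr_eq0 => /eqP.
by rewrite -hdotE exprn_ge0.
Qed.

Let gram_unit : lin_indep -> exists xs, gram xs \in unitmx.
Proof.
move=> Qf; suff [xs] : exists xs, (d <= \rank (gram xs))%N.
  by move=> h; exists xs; rewrite -row_full_unit -col_leq_rank.
have : forall r, (r <= d)%N -> exists xs, (r <= \rank (gram xs))%N; last exact.
elim=> [_|r IH rd]; first by exists [::].
have [xs rxs] := IH (ltnW rd).
have [|lt] := leqP r.+1 (\rank (gram xs)); first by exists xs.
have : kermx (gram xs) != 0.
  rewrite -mxrank_eq0 mxrank_ker -lt0n subn_gt0.
  by apply: leq_ltn_trans rd; rewrite -ltnS.
move=> /rowV0Pn[v /sub_kermxP vk v0].
have [x hx] : exists x, comb (v 0) x != 0.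
  apply: contrapT => /forallNP hn; move/eqP: v0; apply.
  apply/rowP => j; rewrite mxE; apply: Qf j => x.
  by apply/eqP; apply: contrapT => /negP; exact: hn.
exists (x :: xs); apply: leq_ltn_trans rxs _.
apply: (rank_lt_ker (v := v)) => [w /gram_ker hw||/gram_ker h] //.
  by apply/gram_ker => y ys; apply: hw; rewrite in_cons ys orbT.
by rewrite h ?eqxx ?mem_head in hx.
Qed.

(* Makes the coordinate functions elements of [H^oo]. *)
Lemma op_ball_bounded : lin_indep -> exists2 c : R, 0 <= c &
  forall n (X : mxtuple R d n), op_ball n X -> forall j h,
    l2norm (mxact (X j) h) <= c * l2norm h.
Proof.
move=> /gram_unit[xs Gu]; pose W := invmx (gram xs).
pose c : R := \sum_j \sum_k rnorm (W k j : C^o) *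
  \sum_(x <- xs) rnorm (Q k x) * rnorm x.
have c0 j : 0 <= \sum_k rnorm (W k j : C^o) *
    \sum_(x <- xs) rnorm (Q k x) * rnorm x.
  apply: sumr_ge0 => k _; rewrite mulr_ge0 ?rnorm_ge0 // sumr_ge0 // => x _.
  by rewrite mulr_ge0 ?rnorm_ge0.
exists c; first by apply: sumr_ge0.
move=> n X BX j h.
have QX g : l2norm (tensor_eval X g) <= 1 * l2norm g.
  apply: (opnormP _ _).1 g => //; last exact: ltW.
  move=> a g; apply/funext => i; rewrite /tensor_eval scaler_sumr.
  apply: eq_bigr => l _; rewrite scaler_sumr; apply: eq_bigr => k _.
  by rewrite linearZ /= !scalerA mulrC.
pose q x := tensor_eval X (fun k => h k *: x).
have qE x i : q x i = comb (fun j => mxact (X j) h i) x.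
  rewrite /q /tensor_eval /comb; apply: eq_bigr => l _.
  rewrite scaler_suml; apply: eq_bigr => k _.
  by rewrite linearZ /= scalerA.
pose r k i : C^o := \sum_(x <- xs) hdot (q x i) (Q k x).
have uE i : mxact (X j) h i = \sum_k W k j *: r k i.
  pose u : 'rV[C]_d := \row_l mxact (X l) h i.
  have -> : mxact (X j) h i = (u *m gram xs *m W) 0 j.
    by rewrite mulmxK // mxE.
  rewrite mxE; apply: eq_bigr => k _; rewrite mulrC; congr (_ * _).
  rewrite mxE /r; under eq_bigr do rewrite /u mxE.
  by rewrite comb_gram; apply: eq_bigr => x _; rewrite qE.
have -> : mxact (X j) h = fun i => \sum_k W k j *: r k i by apply/funext.
apply: le_trans (ler_l2norm_sum _ _) _.
apply: (@le_trans _ _ ((\sum_k rnorm (W k j : C^o) *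
    \sum_(x <- xs) rnorm (Q k x) * rnorm x) * l2norm h)); last first.
  rewrite ler_wpM2r ?l2norm_ge0 // /c [leRHS](bigD1 j) //= lerDl.
  by apply: sumr_ge0.
rewrite mulr_suml; apply: ler_sum => k _.
rewrite l2normZ -mulrA ler_wpM2l ?rnorm_ge0 //.
apply: le_trans (ler_l2norm_sum _ _) _.
rewrite mulr_suml; apply: ler_sum => x _.
have hq : l2norm (q x) <= rnorm x * l2norm h.
  apply: le_trans (QX _) _; rewrite mul1r le_eqVlt; apply/orP; left; apply/eqP.
  rewrite /l2norm -[X in X * _](ger0_norm (rnorm_ge0 _)) -sqrtr_sqr.
  rewrite -sqrtrM ?sqr_ge0 //; congr Num.sqrt; rewrite mulr_sumr.
  by apply: eq_bigr => l _; rewrite rnormZ exprMn mulrC.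
rewrite -mulrA; apply: le_trans (ler_wpM2l (rnorm_ge0 _) hq).
rewrite l2norm_le ?mulr_ge0 ?rnorm_ge0 ?l2norm_ge0 // exprMn sqr_l2norm.
rewrite mulr_sumr; apply: ler_sum => i _; rewrite -exprMn.
by rewrite ler_pXn2r ?nnegrE ?mulr_ge0 ?rnorm_ge0 // hdot_le.
Qed.

End OperatorBall.

Section Representations.
Context {R : realType} {d : nat}.
Local Notation C := (Cplx R).

Definition homogeneous (V : nc_set R d) : Prop :=
  forall (l : C), `|l| <= 1 -> forall n (X : mxtuple R d n),
    V n X -> V n (fun j => l *: X j).

Definition coord_fun (V : nc_set R d) (j : 'I_d) : graded V :=
  fun n X => \val X j.

(* Maps [A(V) -> M_(n+1)], with the topology of pointwise convergence. *)
Definition rep_space (V : nc_set R d) (n : nat) : Type :=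
  {ptws A_alg V -> 'M[C]_n.+1}.
HB.instance Definition _ V n := Topological.on (rep_space V n).

Definition Rep_cc (V : nc_set R d) n : set (rep_space V n) :=
  [set Phi : A_alg V -> 'M[C]_n.+1 |
    [/\ linear Phi, GRing.monoid_morphism Phi &
    forall m (F : 'M[A_alg V]_m),
      (mxnorm (\mxblock_(j < m, k < m) Phi (F j k))
        <= sup_mxnorm (map_mx val F))%E]].

(* The continuous extension to the closure, as the limit along [V n]: it
   exists for [f] in [A(V)], a uniform limit of polynomials. *)
Definition extend (V : nc_set R d) (f : graded V) n (X : mxtuple R d n) :
    'M[C]_n.+1 :=
  lim ('valL_0 (f n) @ within (V n) (nbhs X)).

Definition Phi_at (V : nc_set R d) n (X : mxtuple R d n) : rep_space V n :=
  fun f => extend (val f) X.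

Section Coordinates.
Context {H K : hilbertType C} {Q : 'I_d -> {linear H -> K}} {V : nc_set R d}.
Hypotheses (Qfree : lin_indep Q) (Vsub : subvariety Q V).

Lemma coord_in_A j : coord_fun j \in A_set (V := V).
Proof.
apply/mem_set/A_setP; split.
- by split=> [m n X Y Z hZ|n X Y S _ hY]; rewrite /coord_fun ?hZ ?hY.
- have [c c0 hc] := op_ball_bounded Qfree; exists c => // n X h; apply: hc.
  have [S _ VS] := Vsub; move: (\val X) (set_mem (valP X)) => Y.
  by rewrite VS => -[Z _ <-]; exact: set_mem (valP Z).
- move=> e e0; exists (mkmalgU (fmu j) 1) => n X h.
  rewrite polyvalU subrr mxact0 l2norm0.
  by rewrite mulr_ge0 ?l2norm_ge0 // ltW.
Qed.

Definition coord_elt (j : 'I_d) : A_alg V := exist _ (coord_fun j) (coord_in_A j).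

Definition rep_pi n (Phi : rep_space V n) : mxtuple R d n :=
  fun j => Phi (coord_elt j).

End Coordinates.
End Representations.

Arguments Rep_cc {R d} V n _.
Arguments Phi_at {R d} V n X _.
Arguments coord_elt {R d H K Q} V Qfree Vsub j.
Arguments rep_pi {R d H K Q} V Qfree Vsub n Phi _.

(* [f] restricts to a homeomorphism of [A] onto [B], with inverse [g]. *)
Definition homeomorphism {T U : topologicalType} (A : set T) (B : set U)
    (f : T -> U) (g : U -> T) : Prop :=
  [/\ set_fun A B f, set_fun B A g,
      {in A, cancel f g} & {in B, cancel g f}] /\
  ({within A, continuous f} /\ {within B, continuous g}).

(* Main.v *)
(** The coordinates X of a completely contractive representation satisfy
    |Q(X)| <= 1, because the compressions of Q(Z) to finite-dimensional
    subspaces are matrices over A(V) of norm at most 1. It remains to see that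
    every f in H^oo(D_Q) vanishing on V vanishes at r^2 X for 0 < r < 1; this
    holds because f(r^2 Y) is, uniformly over |Q(Y)| <= 1, a limit of
    polynomials p(Y): by homogeneity p is small on V, hence so is p(X).

    The approximation needs no complex analysis. On jointly nilpotent tuples f
    is a polynomial, since such tuples are intertwined with a scaled tuple of
    creation operators on a truncated Fock space. The nilpotent tuple
    r Y (x) S, with S the shift of size N+1, is intertwined with r^2 Y up to an
    error so small that the intertwiner can be scaled by a factor of order
    r^(-N) while the resulting upper triangular tuple stays in D_Q. As f is
    bounded, the corner entry of its value there shows that f(r^2 Y) and the
    polynomial read off from f(r Y (x) S) differ by O(r^N). *)
Require Import Defs.
From HB Require Import structures.
From mathcomp Require Import all_boot all_order all_algebra.
From mathcomp Require Import sesquilinear complex.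
From mathcomp Require Import all_classical all_reals all_analysis.
From mathcomp Require Import ring.
From mathcomp Require monalg finmap.
Import -(notations) monalg.

Set Implicit Arguments.
Unset Strict Implicit.
Unset Printing Implicit Defensive.

Import Order.TTheory GRing.Theory Num.Theory.
Import numFieldNormedType.Exports.

Local Open Scope classical_set_scope.
Local Open Scope ring_scope.

Arguments op_ball {R d H K} Q n _.

(** * Norms and the operator ball *)

Definition elt_of (T : Type) (A : set T) (x : T) (Ax : A x) : A :=
  exist (fun y => y \in A) x (mem_set Ax).

Section DirectSum.
Context {R : realType} {m n : nat}.
Local Notation C := (Cplx R).
Implicit Types (A : 'M[C]_m.+1) (B : 'M[C]_n.+1).
Local Notation ls i := (lshift n.+1 i : 'I_(m.+1 + n.+1)).
Local Notation rs i := (rshift m.+1 i : 'I_(m.+1 + n.+1)).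

Lemma mxdsumEul A B i k : mxdsum A B (ls i) (ls k) = A i k.
Proof. exact: (@block_mxEul _ m.+1 n.+1 m.+1 n.+1). Qed.

Lemma mxdsumEur A B i k : mxdsum A B (ls i) (rs k) = 0.
Proof. by apply: etrans (@block_mxEur _ m.+1 n.+1 m.+1 n.+1 _ _ _ _ _ _) _; rewrite mxE. Qed.

Lemma mxdsumEdl A B i k : mxdsum A B (rs i) (ls k) = 0.
Proof. by apply: etrans (@block_mxEdl _ m.+1 n.+1 m.+1 n.+1 _ _ _ _ _ _) _; rewrite mxE. Qed.

Lemma mxdsumEdr A B i k : mxdsum A B (rs i) (rs k) = B i k.
Proof. exact: (@block_mxEdr _ m.+1 n.+1 m.+1 n.+1). Qed.

End DirectSum.

Section Norms.
Context {R : realType}.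
Local Notation C := (Cplx R).

Lemma l2norm_le_scale (E F : normedModType C) m n (g : 'I_m -> E) (h : 'I_n -> F)
    (c : R) : 0 <= c ->
  (l2norm g <= c * l2norm h) =
  (\sum_i rnorm (g i) ^+ 2 <= c ^+ 2 * \sum_i rnorm (h i) ^+ 2).
Proof.
by move=> c0; rewrite l2norm_le ?mulr_ge0 ?l2norm_ge0 // exprMn sqr_l2norm.
Qed.

Lemma linear_rnorm_bound (E F : normedModType C) (f : {linear E -> F}) :
  continuous f -> exists2 c : R, 0 <= c & forall x, rnorm (f x) <= c * rnorm x.
Proof.
move=> fc; have /linear_boundedP/pinfty_ex_gt0[c c0 hc] :=
  continuous_linear_bounded 0 (fc 0).
have cE : c = (rnorm (c : C^o))%:C%C by rewrite rnormE gtr0_norm.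
exists (rnorm (c : C^o)); first exact: rnorm_ge0.
move=> x; rewrite -lecR rmorphM /= !rnormE gtr0_norm //.
Qed.

Lemma l2norm_le_sum (E : normedModType C) n (h : 'I_n -> E) :
  l2norm h <= \sum_k rnorm (h k).
Proof.
rewrite l2norm_le ?sumr_ge0 // => [|k _]; last exact: rnorm_ge0.
rewrite expr2 mulr_suml; apply: ler_sum => k _.
rewrite expr2 ler_wpM2l ?rnorm_ge0 // (bigD1 k) //= lerDl sumr_ge0 // => i _.
exact: rnorm_ge0.
Qed.

Lemma ler_rnorm_sum (E : normedModType C) (I : Type) (r : seq I) (P : pred I)
    (g : I -> E) : rnorm (\sum_(i <- r | P i) g i) <= \sum_(i <- r | P i) rnorm (g i).
Proof.
elim/big_rec2 : _ => [|i y x _ h]; first by rewrite rnorm0.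
by apply: le_trans (ler_rnormD _ _) _; rewrite lerD2l.
Qed.

Lemma rnorm_real (r : R) : 0 <= r -> rnorm (r%:C%C : (C : numFieldType)^o) = r.
Proof. by move=> r0; rewrite /rnorm ger0_norm // -[0]/(0%:C%C) lecR. Qed.

(** On the vector [(0, g)] the upper half of the image is [B g], and padding by zeros keeps the
    norm. *)
Lemma l2norm_mxact_ursub m n (A : 'M[C]_m) (B : 'M[C]_(m, n)) (D : 'M[C]_(n, n))
    (c : R) (g : 'I_n -> C^o) :
  (forall h, l2norm (mxact (block_mx A B 0 D) h) <= c * l2norm h) -> 0 <= c ->
  l2norm (mxact B g) <= c * l2norm g.
Proof.
move=> hB c0; pose h (k : 'I_(m + n)) : C^o :=
  match fintype.split k with inl _ => 0 | inr i => g i end.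
have hl i : h (lshift n i) = 0 by rewrite /h -[lshift n i]/(unsplit (inl i)) unsplitK.
have hr i : h (rshift m i) = g i by rewrite /h -[rshift m i]/(unsplit (inr i)) unsplitK.
have := hB h; rewrite !l2norm_le_scale // => hh.
move: hh; rewrite [X in _ <= _ * X]big_split_ord /= [X in _ <= _ * (X + _)]big1; last first.
  by move=> i _; rewrite hl rnorm0 expr0n.
under [X in _ <= _ * (_ + X)]eq_bigr do rewrite hr.
rewrite add0r; apply: le_trans.
rewrite big_split_ord /= ler_wpDr ?sumr_ge0 // => [i _|]; first exact: sqr_ge0.
apply: ler_sum => i _; rewrite le_eqVlt; apply/orP; left; apply/eqP; congr (rnorm _ ^+ 2).
rewrite /mxact [RHS]big_split_ord /= [X in _ = X + _]big1 ?add0r => [|k _]; last by rewrite hl mulr0.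
by apply: eq_bigr => k _; rewrite block_mxEur hr.
Qed.

End Norms.

Section Tensor.
Context {R : realType} {d : nat} {H K : hilbertType (Cplx R)}.
Local Notation C := (Cplx R).
Variable Q : 'I_d -> {linear H -> K}.

Lemma tensor_evalZ n (X : mxtuple R d n) (a : C) h :
  tensor_eval Q X (fun k => a *: h k) = fun i => a *: tensor_eval Q X h i.
Proof.
apply/funext => i; rewrite /tensor_eval scaler_sumr.
apply: eq_bigr => l _; rewrite scaler_sumr; apply: eq_bigr => k _.
by rewrite linearZ /= !scalerA mulrC.
Qed.

Lemma tensor_eval_scale n (X : mxtuple R d n) (a : C) h :
  tensor_eval Q (fun j => a *: X j) h = fun i => a *: tensor_eval Q X h i.
Proof.
apply/funext => i; rewrite /tensor_eval scaler_sumr.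
apply: eq_bigr => l _; rewrite scaler_sumr; apply: eq_bigr => k _.
by rewrite mxE scalerA.
Qed.

Lemma tensor_normP n (X : mxtuple R d n) (c : R) : 0 <= c ->
  (opnorm (tensor_eval Q X) <= c%:E)%E <->
  forall h, l2norm (tensor_eval Q X h) <= c * l2norm h.
Proof. by move=> c0; apply: opnormP => // a h; exact: tensor_evalZ. Qed.

(** The supremum in [opnorm] is finite here, as it lies between 0 and 1; it then serves as the real
    constant [c]. *)
Lemma op_ballP n (X : mxtuple R d n) : op_ball Q n X <->
  exists c : R, [/\ 0 <= c, c < 1 &
    forall h, l2norm (tensor_eval Q X h) <= c * l2norm h].
Proof.
rewrite /op_ball /=; split=> [X1|[c [c0 c1 /tensor_normP Xc]]]; last first.
  by apply: le_lt_trans (Xc c0) _; rewrite lte_fin.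
have x0 : (0%E <= opnorm (tensor_eval Q X))%E.
  apply: le_trans (_ : (l2norm (tensor_eval Q X (fun=> 0)))%:E <= _)%E.
    by rewrite lee_fin l2norm_ge0.
  by apply: ereal_sup_ubound; exists (fun=> 0); rewrite //= l2norm0.
have fx : opnorm (tensor_eval Q X) \is a fin_num.
  rewrite fin_numE gt_eqF ?lt_eqF //; first by rewrite (lt_trans X1) ?ltry.
  by apply: lt_le_trans x0; rewrite ltNyr.
exists (fine (opnorm (tensor_eval Q X))); split; first exact: fine_ge0.
  by rewrite -lte_fin fineK.
by apply/tensor_normP; rewrite ?fine_ge0 // fineK.
Qed.

(* [Z] is [Y (x) B], with index set ['I_n.+1 * J] enumerated by [e]. *)
Lemma tensor_ampliation n p (J : finType) (e : 'I_p.+1 -> 'I_n.+1 * J)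
    (B : J -> J -> C) (q r : R) (Y : mxtuple R d n) (Z : mxtuple R d p) :
  bijective e -> 0 <= q -> 0 <= r ->
  (forall x : J -> H, \sum_a rnorm (\sum_b B a b *: x b) ^+ 2 <=
     r ^+ 2 * \sum_a rnorm (x a) ^+ 2) ->
  (forall h, l2norm (tensor_eval Q Y h) <= q * l2norm h) ->
  (forall j a b, Z j a b = Y j (e a).1 (e b).1 * B (e a).2 (e b).2) ->
  forall h, l2norm (tensor_eval Q Z h) <= q * r * l2norm h.
Proof.
move=> be q0 r0 hB hY hZ h; rewrite l2norm_le_scale ?mulr_ge0 //.
case: (be) => e' eK e'K.
(* [g s] is the slice [s] of [(1 (x) B) h], so that [Q(Z)] becomes [Q(Y)] applied to each slice. *)
pose g s (k : 'I_n.+1) : H := \sum_t B s t *: h (e' (k, t)).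
have TE a : tensor_eval Q Z h a = tensor_eval Q Y (g (e a).2) (e a).1.
  rewrite /tensor_eval; apply: eq_bigr => j _.
  rewrite (reindex e') /=; last by exists e => x _.
  under [RHS]eq_bigr do rewrite /g linear_sum scaler_sumr.
  rewrite pair_bigA /=; apply: eq_bigr => -[k t] _ /=.
  by rewrite hZ e'K linearZ scalerA.
under eq_bigr do rewrite TE.
rewrite (reindex e') /=; last by exists e => x _.
rewrite [X in _ <= _ * X](reindex e') /=; last by exists e => x _.
have -> : \sum_j rnorm (tensor_eval Q Y (g (e (e' j)).2) (e (e' j)).1) ^+ 2 =
    \sum_i \sum_s rnorm (tensor_eval Q Y (g s) i) ^+ 2.
  by rewrite pair_bigA; apply: eq_bigr => p0 _; rewrite e'K.
have -> : \sum_j rnorm (h (e' j)) ^+ 2 = \sum_i \sum_s rnorm (h (e' (i, s))) ^+ 2.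
  by rewrite pair_bigA; apply: eq_bigr => -[].
rewrite exchange_big /=.
apply: (@le_trans _ _ (\sum_s q ^+ 2 * \sum_k rnorm (g s k) ^+ 2)).
  by apply: ler_sum => s _; rewrite -l2norm_le_scale.
rewrite -mulr_sumr exchange_big /= exprMn -[leRHS]mulrA ler_wpM2l ?sqr_ge0 //.
rewrite mulr_sumr; apply: ler_sum => k _; exact: hB.
Qed.

(** Up to reordering, [Q(X (+) Y)] is the direct sum of [Q(X)] and [Q(Y)], whose norm is the larger
    of the two. *)
Lemma op_ball_dsum m n (X : mxtuple R d m) (Y : mxtuple R d n)
    (Z : mxtuple R d (m + n.+1)%N) :
  op_ball Q m X -> op_ball Q n Y -> (forall j, Z j = mxdsum (X j) (Y j)) ->
  op_ball Q _ Z.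
Proof.
move=> /op_ballP[a [a0 a1 hX]] /op_ballP[b [b0 b1 hY]] hZ; apply/op_ballP.
have c0 : 0 <= Num.max a b by rewrite le_max a0.
exists (Num.max a b); split => //; first by rewrite gt_max a1.
move=> h; rewrite l2norm_le_scale //.
pose hl k := h (lshift n.+1 k : 'I_(m.+1 + n.+1)).
pose hr k := h (rshift m.+1 k : 'I_(m.+1 + n.+1)).
have El i : tensor_eval Q Z h (lshift n.+1 i : 'I_(m.+1 + n.+1)) = tensor_eval Q X hl i.
  rewrite /tensor_eval; apply: eq_bigr => j _; rewrite (@big_split_ord _ _ _ m.+1 n.+1) /=.
  rewrite [X in _ + X]big1 => [|k _]; last by rewrite hZ mxdsumEur scale0r.
  by rewrite addr0; apply: eq_bigr => k _; rewrite hZ mxdsumEul.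
have Er i : tensor_eval Q Z h (rshift m.+1 i : 'I_(m.+1 + n.+1)) = tensor_eval Q Y hr i.
  rewrite /tensor_eval; apply: eq_bigr => j _; rewrite (@big_split_ord _ _ _ m.+1 n.+1) /=.
  rewrite [X in X + _]big1 => [|k _]; last by rewrite hZ mxdsumEdl scale0r.
  by rewrite add0r; apply: eq_bigr => k _; rewrite hZ mxdsumEdr.
rewrite (@big_split_ord _ _ _ m.+1 n.+1) /= [X in _ <= _ * X](@big_split_ord _ _ _ m.+1 n.+1) /=.
under eq_bigr do rewrite El.
under [X in _ + X <= _]eq_bigr do rewrite Er.
rewrite mulrDr; apply: lerD.
  rewrite -l2norm_le_scale //; apply: le_trans (hX _) _.
  by rewrite ler_wpM2r ?l2norm_ge0 // le_max lexx.
rewrite -l2norm_le_scale //; apply: le_trans (hY _) _.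
by rewrite ler_wpM2r ?l2norm_ge0 // le_max lexx orbT.
Qed.

Lemma op_ball_absorbing (Qcont : forall j, continuous (Q j)) n
    (X : mxtuple R d n) :
  exists2 e : R, 0 < e & op_ball Q _ ((fun j => e%:C%C *: X j) : mxtuple R d n).
Proof.
have /choice[c hc] : forall j, exists c : R,
    0 <= c /\ forall x, rnorm (Q j x) <= c * rnorm x.
  by move=> j; have [c c0 hc] := linear_rnorm_bound (@Qcont j); exists c.
(* A crude bound on the norm of [Q(X)], entry by entry. The scale [1/(b + 1)] brings it below 1,
   also when [b = 0]. *)
pose b : R := \sum_i \sum_j \sum_k rnorm (X j i k : C^o) * c j.
have b0 : 0 <= b.
  apply: sumr_ge0 => i _; apply: sumr_ge0 => j _; apply: sumr_ge0 => k _.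
  by rewrite mulr_ge0 ?rnorm_ge0 // (hc j).1.
have hb h : l2norm (tensor_eval Q X h) <= b * l2norm h.
  apply: le_trans (l2norm_le_sum _) _; rewrite mulr_suml; apply: ler_sum => i _.
  apply: le_trans (ler_rnorm_sum _ _ _) _; rewrite mulr_suml; apply: ler_sum => j _.
  apply: le_trans (ler_rnorm_sum _ _ _) _; rewrite mulr_suml; apply: ler_sum => k _.
  rewrite rnormZ -mulrA ler_wpM2l ?rnorm_ge0 //.
  apply: le_trans ((hc j).2 _) _; rewrite ler_wpM2l ?(hc j).1 //.
  exact: rnorm_le_l2norm.
have b1 : 0 < b + 1 by rewrite ltr_wpDl.
exists (b + 1)^-1; first by rewrite invr_gt0.
apply/op_ballP; exists ((b + 1)^-1 * b); split.
- by rewrite mulr_ge0 // invr_ge0 ltW.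
- by rewrite mulrC ltr_pdivrMr // mul1r ltrDl.
move=> h; set a : C := _%:C%C.
rewrite (tensor_eval_scale X).
rewrite l2normZ -mulrA [X in X * _](_ : _ = (b + 1)^-1).
  by rewrite ler_wpM2l // invr_ge0 ltW.
by rewrite /rnorm ger0_norm // /a -[0]/(0%:C%C) lecR invr_ge0 ltW.
Qed.

End Tensor.

(** * Intertwining and nilpotent tuples *)

Section NCIntertwining.
Context {R : realType} {d : nat}.
Local Notation C := (Cplx R).
Variables (Omega : nc_set R d) (f : graded Omega).
Arguments Omega : clear implicits.
Arguments f : clear implicits.
Hypothesis fnc : nc_fun f.

(* [X (+) Y] is conjugated by the unipotent matrix [1 T; 0 1]. *)
Lemma nc_fun_block m n (X : Omega m) (Y : Omega n) (W Z : Omega (m + n.+1)%N)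
    (T : 'M[C]_(m.+1, n.+1)) :
  (forall j, \val W j = mxdsum (\val X j) (\val Y j)) ->
  (forall j, \val Z j = block_mx (\val X j) (\val X j *m T - T *m \val Y j) 0 (\val Y j)) ->
  f _ Z = block_mx (f _ X) (f _ X *m T - T *m f _ Y) 0 (f _ Y).
Proof.
move=> hW hZ.
pose S : 'M[C]_(m.+1 + n.+1) := block_mx 1%:M T 0 1%:M.
pose S' : 'M[C]_(m.+1 + n.+1) := block_mx 1%:M (- T) 0 1%:M.
have S'S : S' *m S = 1%:M.
  rewrite mulmx_block !mul1mx !mulmx1 !mul0mx !mulmx0 !addr0 add0r addrN.
  by rewrite -scalar_mx_block.
have [S'u Su] := mulmx1_unit S'S.
have iS : invmx S = S' by rewrite -[LHS]mul1mx -S'S mulmxK.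
(* Conjugation by [S] puts [A T - T B] in the corner, for the tuples and for the values of [f]
   alike. *)
have conj (A : 'M[C]_m.+1) (B : 'M[C]_n.+1) :
    S' *m block_mx A 0 0 B *m S = block_mx A (A *m T - T *m B) 0 B.
  rewrite !mulmx_block !mul1mx !mulmx1 !mul0mx !mulmx0 !addr0 !add0r.
  by rewrite mulNmx mul0mx add0r.
have := fnc.2 _ W Z S Su; rewrite iS => ->.
  by rewrite (fnc.1 _ _ X Y W hW); exact: conj.
by move=> j; rewrite hZ hW; exact: esym (conj _ _).
Qed.

(** If [T] intertwines the tuples, conjugation by [[1 T; 0 1]] fixes [X (+) Y], so the corner
    [f(X) T - T f(Y)] of the conjugated value has to vanish. *)
Lemma nc_fun_intertwine m n (X : Omega m) (Y : Omega n) (W : Omega (m + n.+1)%N)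
    (T : 'M[C]_(m.+1, n.+1)) :
  (forall j, \val W j = mxdsum (\val X j) (\val Y j)) ->
  (forall j, \val X j *m T = T *m \val Y j) -> f _ X *m T = T *m f _ Y.
Proof.
move=> hW hT; have := @nc_fun_block _ _ X Y W W T hW.
rewrite (fnc.1 _ _ X Y W hW) /mxdsum => h.
have /h {h}: forall j, \val W j = block_mx (\val X j) (\val X j *m T - T *m \val Y j) 0 (\val Y j).
  by move=> j; rewrite hW hT subrr.
by move=> /(@eq_block_mx _ m.+1 n.+1 m.+1 n.+1)[_ /esym/subr0_eq].
Qed.

End NCIntertwining.

(** This enumeration lets words and pairs serve as matrix indices. An element of [J] rules out size
    zero. *)
Lemma finType_ord_bij (J : finType) : J ->
  exists p (e : 'I_p.+1 -> J), bijective e.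
Proof.
move=> x0; have h : #|J|.-1.+1 = #|J| by rewrite prednK //; apply/card_gt0P; exists x0.
exists #|J|.-1, (fun i => enum_val (cast_ord h i)).
exists (fun x => cast_ord (esym h) (enum_rank x)) => x.
  by rewrite enum_valK cast_ordK.
by rewrite cast_ordKV enum_rankK.
Qed.

Section Words.
Context {R : realType} {d : nat}.
Local Notation C := (Cplx R).

Lemma polyval_sum_words (I : finType) (a : I -> C) (w : I -> seq 'I_d) :
  exists p : freepoly R d, forall n (X : mxtuple R d n),
    polyval p X = \sum_i a i *: \prod_(j <- w i) X j.
Proof.
exists (\sum_i a i *: mkmalgU (FMonom (w i)) 1) => n X.
have E (s : seq I) : polyval (\sum_(i <- s) a i *: mkmalgU (FMonom (w i)) 1) X =
    \sum_(i <- s) a i *: \prod_(j <- w i) X j.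
  elim: s => [|i s IH]; first by rewrite !big_nil /polyval mmap0.
  by rewrite !big_cons polyvalP IH /polyval mmapU mul1r.
exact: E.
Qed.

Context {H K : hilbertType (Cplx R)}.
Variable Q : 'I_d -> {linear H -> K}.
Hypothesis Qcont : forall j, continuous (Q j).

(* The model is [e *: L], [L] the creation operators on words of length at
   most [N]: every jointly nilpotent [Y] is intertwined with it. *)
Lemma nc_fun_nilpotent (f : graded (op_ball Q)) (N : nat) : nc_fun f ->
  exists c : N.-bseq 'I_d -> C, forall n (Y : op_ball Q n),
    (forall w : seq 'I_d, size w = N.+1 -> \prod_(j <- w) \val Y j = 0) ->
    f n Y = \sum_(w : N.-bseq 'I_d) c w *: \prod_(j <- w) \val Y j.
Proof.
move=> fnc; have [M [e be]] := finType_ord_bij ([bseq] : N.-bseq 'I_d).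
case: (be) => e' eK e'K.
pose L : mxtuple R d M := fun j => \matrix_(a, b) ((e a : seq _) == j :: e b)%:R.
have [x x0 Lx] := op_ball_absorbing Qcont L.
pose A : op_ball Q M := elt_of Lx.
pose eps : C := x%:C%C.
have eps0 : eps != 0.
  by rewrite -[0]/(0%:C%C) (inj_eq (@complexI R)) gt_eqF.
(* The coefficients are read off from the column of the empty word in [f(A)]; the power of [eps]
   undoes the scaling of the creation operators. *)
exists (fun w : N.-bseq 'I_d => eps ^- size w * f M A (e' w) (e' [bseq])) => n Y Y0.
apply/matrixP => i k.
pose P (w : seq 'I_d) := \prod_(j <- w) \val Y j.
(* Column [w] of [T] is column [k] of [w(Y)] divided by [eps^|w|], so that prolonging a word by
   [A_j] matches multiplication by [Y_j]. *)
pose T : 'M[C]_(n.+1, M.+1) := \matrix_(l, a) (eps ^- size (e a) * P (e a) l k).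
have YT j : \val Y j *m T = T *m \val A j.
  apply/matrixP => l b; rewrite !mxE.
  have -> : \sum_m \val Y j l m * T m b = eps ^- size (e b) * P (j :: e b) l k.
    rewrite /P big_cons -/(P _) -[\val Y j * _]/(_ *m _) mxE mulr_sumr.
    by apply: eq_bigr => m _; rewrite mxE mulrCA.
  (* For a word of length [N] both sides vanish: the left by nilpotency, the right because the
     prolonged word is too long for the model. *)
  have [s|s] := ltnP (size (e b)) N; last first.
    have sN : size (e b) = N by apply/eqP; rewrite eqn_leq s size_bseq.
    rewrite /P Y0 ?mxE ?mulr0 /= ?sN // big1 // => a _; rewrite !mxE.
    case: eqP => [ha|_]; last by rewrite !mulr0.
    by have := size_bseq (e a); rewrite ha /= sN ltnn.
  pose w : N.-bseq 'I_d := @Bseq N _ (j :: e b) s.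
  rewrite (bigD1 (e' w)) //= big1 => [|a aw].
    rewrite !mxE e'K eqxx mulr1 addr0 /=.
    by rewrite exprS invfM [_ * eps]mulrC !mulrA divff // mul1r.
  rewrite !mxE; case: eqP => [ha|_]; last by rewrite !mulr0.
  by move: aw; rewrite -[a]eK (_ : e a = w) ?eqxx //; apply/val_inj.
have WB : op_ball Q _ ((fun j => mxdsum (\val Y j) (\val A j)) : mxtuple R d (n + M.+1)%N).
  by apply: (op_ball_dsum (X := \val Y) (Y := \val A)) => //; exact: set_mem (valP _).
pose W : op_ball Q (n + M.+1)%N := elt_of WB.
(* The column of the empty word in [T] is the basis vector [e_k], so [f(Y) T] has column [k] of
   [f(Y)] there. *)
have /matrixP/(_ i (e' [bseq])) :=
  nc_fun_intertwine fnc (X := Y) (Y := A) (W := W) (fun=> erefl) YT.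
rewrite !mxE (bigD1 k) //= big1 ?addr0 => [|l lk]; last first.
  by rewrite mxE e'K /P big_nil mxE (negbTE lk) mulr0n !mulr0.
rewrite mxE e'K /P big_nil mxE eqxx expr0 invr1 !mulr1 => ->.
rewrite summxE (reindex e') /=; last by exists e => z _.
by apply: eq_bigr => w _; rewrite !mxE e'K mulrAC.
Qed.

End Words.

(** * Uniform polynomial approximation of dilates *)

Section Reindexing.
Variables (V : nmodType) (P : nat) (I J : finType) (e : 'I_P -> I * J).
Hypothesis be : bijective e.

Lemma sum_pair_bij (F : I * J -> V) :
  \sum_a F (e a) = \sum_i \sum_j F (i, j).
Proof.
case: (be) => e' eK e'K; rewrite pair_bigA (reindex e) /=; last by exists e' => x _.
by apply: eq_bigr => a _; rewrite -surjective_pairing.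
Qed.

End Reindexing.

Lemma sum_option (V : nmodType) (J : finType) (F : option J -> V) :
  \sum_a F a = F None + \sum_j F (Some j).
Proof.
rewrite (bigD1 None) //=; congr (_ + _).
rewrite (reindex_omap Some id) /=; last by case.
by apply: eq_bigl => j; rewrite eqxx.
Qed.

Lemma big_delta (S : pzSemiRingType) (I : finType) (i : I) (F : I -> S) :
  \sum_k (i == k)%:R * F k = F i.
Proof.
rewrite (bigD1 i) //= eqxx mul1r big1 ?addr0 // => k ki.
by rewrite eq_sym (negbTE ki) mul0r.
Qed.

Section Shift.
Context {R : realType} {d : nat} {E : normedModType (Cplx R)}.
Local Notation C := (Cplx R).

Definition shift_coef (N : nat) (s t : 'I_N.+1) : C := (s == t.+1 :> nat)%:R.

(** The truncated shift is isometric but for the last coordinate, which it drops. *)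
Lemma shift_sqr_norm N (x : 'I_N.+1 -> E) :
  \sum_s rnorm (\sum_t shift_coef s t *: x t) ^+ 2 + rnorm (x ord_max) ^+ 2 =
  \sum_t rnorm (x t) ^+ 2.
Proof.
rewrite [RHS]big_ord_recr /=; congr (_ + _).
rewrite big_ord_recl big1 => [|t _]; last by rewrite /shift_coef scale0r.
rewrite rnorm0 expr0n add0r; apply: eq_bigr => i _; congr (rnorm _ ^+ 2).
rewrite (bigD1 (widen_ord (leqnSn N) i)) //= big1 => [|t ti].
  by rewrite /shift_coef /= /bump /= add1n eqxx scale1r addr0.
rewrite /shift_coef /= /bump /= add1n eqSS (_ : _ == _ = false) ?scale0r //.
by apply/negbTE; rewrite eq_sym; apply: contraNneq ti => h; apply/eqP/val_inj.
Qed.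

Lemma shift_contraction N (r : R) (x : 'I_N.+1 -> E) : 0 <= r ->
  \sum_s rnorm (\sum_t (r%:C%C * shift_coef s t) *: x t) ^+ 2 <=
  r ^+ 2 * \sum_t rnorm (x t) ^+ 2.
Proof.
move=> r0; rewrite -(shift_sqr_norm x) mulrDr ler_wpDr ?mulr_ge0 ?rnorm_ge0 //.
rewrite mulr_sumr; apply: ler_sum => s _.
under eq_bigr do rewrite -scalerA.
by rewrite -scaler_sumr rnormZ rnorm_real // exprMn.
Qed.

(* The matrix [[r, s e_N], [0, S]], with [S] the shift and [s^2 = 1 - r^2]. *)
Definition shift_ext (N : nat) (r : R) (a b : option 'I_N.+1) : C :=
  match a, b with
  | None, None => r%:C%C
  | None, Some t => (t == ord_max)%:R * (Num.sqrt (1 - r ^+ 2))%:C%C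
  | Some _, None => 0
  | Some s, Some t => shift_coef s t
  end.

(** The first row obeys [|r u + s v|^2 <= |u|^2 + |v|^2] by Cauchy-Schwarz, since [r^2 + s^2 = 1].
    The last coordinate [v] that it uses is just what the shift rows lose. *)
Lemma shift_ext_contraction N (r : R) (x : option 'I_N.+1 -> E) :
  0 <= r -> r <= 1 ->
  \sum_a rnorm (\sum_b (r%:C%C * shift_ext r a b) *: x b) ^+ 2 <=
  r ^+ 2 * \sum_a rnorm (x a) ^+ 2.
Proof.
move=> r0 r1; pose s := Num.sqrt (1 - r ^+ 2).
have s2 : s ^+ 2 = 1 - r ^+ 2 by rewrite sqr_sqrtr // subr_ge0 expr_le1.
under eq_bigr do under eq_bigr do rewrite -scalerA.
under eq_bigr do rewrite -scaler_sumr rnormZ rnorm_real // exprMn.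
rewrite -mulr_sumr ler_wpM2l ?sqr_ge0 //.
rewrite !sum_option -(shift_sqr_norm (fun t => x (Some t))) addrA addrAC.
apply: lerD; last first.
  by apply: ler_sum => t _; rewrite sum_option scale0r add0r.
rewrite (bigD1 ord_max) //= big1 => [|t /negbTE tN]; last first.
  by rewrite tN mul0r scale0r.
rewrite eqxx mul1r addr0 -/s.
apply: (@le_trans _ _ ((r * rnorm (x None) + s * rnorm (x (Some ord_max))) ^+ 2)).
  rewrite ler_pXn2r ?nnegrE ?addr_ge0 ?mulr_ge0 ?rnorm_ge0 ?sqrtr_ge0 //.
  apply: le_trans (ler_rnormD _ _) _; rewrite !rnormZ !rnorm_real ?sqrtr_ge0 //.
set u := rnorm _; set v := rnorm _.
rewrite -subr_ge0 (_ : _ - _ = (s * u - r * v) ^+ 2) ?sqr_ge0 //.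
rewrite -[X in X - _]mul1r -[1](subrK (r ^+ 2)) -s2; ring.
Qed.

(* The words in [Z = Y (x) z S] are [w(Y) (x) (z S)^|w|]. *)
Lemma prod_ampliation n P N (e : 'I_P.+1 -> 'I_n.+1 * 'I_N.+1)
    (Y : mxtuple R d n) (Z : mxtuple R d P) (z : C) (w : seq 'I_d) a b :
  bijective e ->
  (forall j a b, Z j a b = Y j (e a).1 (e b).1 * (z * shift_coef (e a).2 (e b).2)) ->
  (\prod_(j <- w) Z j) a b = (\prod_(j <- w) Y j) (e a).1 (e b).1 *
    (z ^+ size w * ((e a).2 == (e b).2 + size w :> nat)%N%:R).
Proof.
move=> be hZ; elim: w a => [|j w IH] a.
  rewrite !big_nil !mxE expr0 mul1r addn0 -natrM mulnb; congr (nat_of_bool _)%:R.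
  by rewrite -(inj_eq (bij_inj be)) -pair_eqE /= .
rewrite !big_cons -[_ * _]/(_ *m _) mxE -[Y j * _]/(_ *m _) mxE.
under [LHS]eq_bigr => k do rewrite hZ IH.
rewrite (sum_pair_bij be (fun p => Y j (e a).1 p.1 * (z * shift_coef (e a).2 p.2) *
  ((\prod_(j0 <- w) Y j0) p.1 (e b).1 *
     (z ^+ size w * (p.2 == (e b).2 + size w :> nat)%N%:R)))) mulr_suml.
apply: eq_bigr => k _ /=.
under eq_bigr => t _ do rewrite mulrACA [z * _ * _]mulrACA -exprS.
rewrite -mulr_sumr; congr (_ * _); rewrite -mulr_sumr; congr (_ * _).
have [ab|ab] := eqVneq ((e a).2 : nat) ((e b).2 + (size w).+1)%N; last first.
  rewrite big1 // => t _; rewrite /shift_coef; case: eqP => [h1|]; last by rewrite mul0r.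
  case: eqP => [h2|]; last by rewrite mulr0.
  by move: ab; rewrite h1 h2 addnS eqxx.
have tN : ((e b).2 + size w < N.+1)%N by apply: leq_ltn_trans (ltn_ord (e a).2); rewrite ab leq_add2l.
rewrite (bigD1 (Ordinal tN)) //= big1 => [|t tt].
  by rewrite /shift_coef /= ab addnS !eqxx mulr1 addr0.
rewrite [_ == _](_ : _ = false) ?mulr0 //; apply/negbTE; apply: contraNneq tt => h.
exact/eqP/val_inj.
Qed.
End Shift.

Section DilationApprox.
Context {R : realType} {d : nat} {H K : hilbertType (Cplx R)}.
Local Notation C := (Cplx R).
Variable Q : 'I_d -> {linear H -> K}.
Hypothesis Qcont : forall j, continuous (Q j).

(* [T = k (1, r, .., r^N) (x) 1] intertwines [X = r^2 Y] and [Z = r Y (x) S]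
   up to an error supported on the last column. With [k = s / r^(N+1)] and
   [s^2 = 1 - r^2], the tuple [X, X T - T Z; 0, Z] is [Y (x) r (shift_ext r)],
   which lies in the ball. *)
Lemma dilation_gap (f : graded (op_ball Q)) N (M r : R) n (Y : mxtuple R d n)
    (c : N.-bseq 'I_d -> C) (X : op_ball Q n) : nc_fun f -> 0 <= M ->
  (forall m (Z : op_ball Q m) h, l2norm (mxact (f _ Z) h) <= M * l2norm h) ->
  (forall m (Z : op_ball Q m),
    (forall w : seq 'I_d, size w = N.+1 -> \prod_(j <- w) \val Z j = 0) ->
    f m Z = \sum_(w : N.-bseq 'I_d) c w *: \prod_(j <- w) \val Z j) ->
  0 < r -> r < 1 ->
  (forall h, l2norm (tensor_eval Q Y h) <= l2norm h) ->
  (forall j, \val X j = (r%:C%C ^+ 2) *: Y j) ->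
  forall v, l2norm (mxact (f n X -
      \sum_(w : N.-bseq 'I_d) (c w * (r%:C%C ^+ 2) ^+ size w) *: \prod_(j <- w) Y j) v)
    <= M * (r ^+ N.+1 / Num.sqrt (1 - r ^+ 2)) * l2norm v.
Proof.
move=> fnc M0 hM hc r0 r1 hY hX v.
pose s := Num.sqrt (1 - r ^+ 2).
have s0 : 0 < s by rewrite sqrtr_gt0 subr_gt0 expr_lt1 // ltW.
pose z : C := r%:C%C.
pose k : C := (s / r ^+ N.+1)%:C%C.
have kz : k * z ^+ N.+1 = s%:C%C.
  by rewrite /k /z -rmorphXn -rmorphM divfK // expf_neq0 // gt_eqF.
have [P [e be]] := finType_ord_bij ((ord0, ord0) : 'I_n.+1 * 'I_N.+1).
case: (be) => e' eK e'K.
have hY1 h : l2norm (tensor_eval Q Y h) <= 1 * l2norm h by rewrite mul1r.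
pose Z : mxtuple R d P := fun j => \matrix_(a, b)
  (Y j (e a).1 (e b).1 * (z * @shift_coef R N (e a).2 (e b).2)).
have ZE j a b : Z j a b = Y j (e a).1 (e b).1 * (z * @shift_coef R N (e a).2 (e b).2).
  by rewrite mxE.
have ZB : op_ball Q P Z.
  apply/op_ballP; exists (1 * r); split; rewrite ?mul1r ?(ltW r0) //.
  move=> h; rewrite -[r]mul1r.
  apply: (tensor_ampliation be _ _ _ hY1 ZE) => // [|x]; first exact: ltW.
  by apply: shift_contraction; exact: ltW.
pose T : 'M[C]_(n.+1, P.+1) :=
  \matrix_(i, a) (k * z ^+ (e a).2 * (i == (e a).1)%:R).
pose U : mxtuple R d (n + P.+1)%N := fun j =>
  block_mx (\val X j) (\val X j *m T - T *m Z j) 0 (Z j).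
(* Below the last column the two products cancel, as [r^2 r^t = r r^(t+1)]. The last column of [S]
   is zero, so there [k r^(N+2) = r s] survives. *)
have TE j i a : (\val X j *m T - T *m Z j) i a =
    Y j i (e a).1 * (z * ((e a).2 == ord_max)%:R * s%:C%C).
  rewrite !mxE.
  have -> : \sum_l \val X j i l * T l a = z ^+ 2 * Y j i (e a).1 * (k * z ^+ (e a).2).
    under eq_bigr do rewrite mxE hX mxE eq_sym mulrA mulrC.
    by rewrite big_delta.
  have -> : \sum_b T i b * Z j b a =
      z * Y j i (e a).1 * (k * z ^+ (e a).2.+1 * ((e a).2 != ord_max)%:R).
    under eq_bigr do rewrite mxE ZE mulrC.
    rewrite (sum_pair_bij be (fun p => Y j p.1 (e a).1 * (z * @shift_coef R N p.2 (e a).2) *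
       (k * z ^+ p.2 * (i == p.1)%:R))) /=.
    under eq_bigr => l _.
      under eq_bigr => t _ do rewrite mulrA [_ * (i == l)%:R]mulrC.
      rewrite -mulr_sumr; over.
    rewrite big_delta.
    have [->|aN] := eqVneq (e a).2 ord_max.
      rewrite !mulr0 big1 // => t _; rewrite /shift_coef /=.
      by rewrite ltn_eqF ?mulr0 ?mul0r.
    have tN : ((e a).2.+1 < N.+1)%N.
      by rewrite ltnS ltn_neqAle -ltnS ltn_ord andbT.
    rewrite (bigD1 (Ordinal tN)) //= big1 => [|t tt].
      by rewrite /shift_coef /= eqxx !mulr1 addr0 [Y _ _ _ * z]mulrC.
    rewrite /shift_coef (_ : _ == _ = false) ?mulr0 ?mul0r //.
    by apply/negbTE; apply: contraNneq tt => h; apply/eqP/val_inj.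
  have [->|aN] := eqVneq (e a).2 ord_max.
    rewrite -kz [z ^+ N.+1]exprS /= !mulr0 subr0 mulr1n; ring.
  by rewrite [z ^+ (e a).2.+1]exprS /= mulr1n mulr0n; ring.
have UB : op_ball Q _ U.
  apply/op_ballP; exists (1 * r); split; rewrite ?mul1r ?(ltW r0) //.
  move=> h; rewrite -[r]mul1r.
  (* [None] marks the block of [X] and [Some t] the slices of [Z]; with these indices [U] is
     [Y (x) r (shift_ext r)]. *)
  pose e2 (a : 'I_(n.+1 + P.+1)) : 'I_n.+1 * option 'I_N.+1 :=
    match fintype.split a with inl i => (i, None) | inr b => ((e b).1, Some (e b).2) end.
  have be2 : bijective e2.
    exists (fun p => if p.2 is Some t then rshift n.+1 (e' (p.1, t)) else lshift P.+1 p.1).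
      move=> a; rewrite -(splitK a); case: (fintype.split a) => [i|b]; rewrite /e2 unsplitK /=.
        by [].
      by rewrite -surjective_pairing eK.
    move=> [i [t|]]; rewrite /e2 /=.
      by rewrite -[rshift _ _]/(unsplit (inr _)) unsplitK e'K.
    by rewrite -[lshift _ _]/(unsplit (inl _)) unsplitK.
  apply: (@tensor_ampliation _ _ _ _ _ n (n + P.+1) _ e2
    (fun a b => z * @shift_ext R N r a b) 1 r Y) => // [|x|j a b]; first exact: ltW.
    by apply: shift_ext_contraction; exact: ltW.
  rewrite -(@splitK n.+1 P.+1 a) -(@splitK n.+1 P.+1 b).
  case: (@fintype.split n.+1 P.+1 a) => [i|a']; case: (@fintype.split n.+1 P.+1 b) => [l|b'];
    rewrite /e2 !unsplitK /U /=.
  - by apply: etrans (@block_mxEul _ n.+1 P.+1 n.+1 P.+1 _ _ _ _ _ _) _; rewrite hX mxE mulrC.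
  - by apply: etrans (@block_mxEur _ n.+1 P.+1 n.+1 P.+1 _ _ _ _ _ _) _; rewrite TE -mulrA.
  - by apply: etrans (@block_mxEdl _ n.+1 P.+1 n.+1 P.+1 _ _ _ _ _ _) _; rewrite mxE !mulr0.
  - by apply: etrans (@block_mxEdr _ n.+1 P.+1 n.+1 P.+1 _ _ _ _ _ _) _; rewrite ZE.
pose Z' := elt_of ZB; pose U' := elt_of UB.
have WB : op_ball Q _ ((fun j => mxdsum (\val X j) (Z j)) : mxtuple R d (n + P.+1)%N).
  by apply: (op_ball_dsum (X := \val X) (Y := Z)) => //; exact: set_mem (valP _).
have fU := nc_fun_block fnc (X := X) (Y := Z') (W := elt_of WB) (Z := U') (T := T)
  (fun=> erefl) (fun=> erefl).
(* [G] embeds [C^(n+1)] isometrically as the slice 0, on which [T] acts as the scalar [k]. *)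
pose G : 'M[C]_(P.+1, n.+1) := \matrix_(a, i) (((e a).2 == ord0) && ((e a).1 == i))%:R.
have fZ : f P Z' = \sum_(w : N.-bseq 'I_d) c w *: \prod_(j <- w) Z j.
  apply: hc => w sw; apply/matrixP => a b.
  rewrite (prod_ampliation w a b be ZE) mxE sw.
  rewrite (_ : _ == _ = false) ?mulr0 //; apply/negbTE; rewrite neq_ltn.
  by rewrite (leq_trans (ltn_ord _)) // leq_addl.
have FG (F : 'I_P.+1 -> C) i : \sum_a F a * G a i = F (e' (i, ord0)).
  under eq_bigr => a _ do rewrite mxE -{1}[a]eK.
  rewrite (sum_pair_bij be (fun p => F (e' p) * ((p.2 == ord0) && (p.1 == i))%:R)) /=.
  under eq_bigr => l _.
    under eq_bigr => t _ do rewrite -mulnb natrM mulrC -mulrA eq_sym [l == i]eq_sym.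
    rewrite big_delta; over.
  by rewrite big_delta.
have TF (F : 'I_P.+1 -> C) i :
    \sum_a T i a * F a = k * \sum_(t < N.+1) z ^+ t * F (e' (i, t)).
  under eq_bigr => a _ do rewrite mxE -{3}[a]eK.
  rewrite (sum_pair_bij be (fun p => k * z ^+ p.2 * (i == p.1)%:R * F (e' p))) /=.
  under eq_bigr => l _.
    under eq_bigr => t _ do rewrite mulrAC [_ * _%:R]mulrC.
    rewrite -mulr_sumr; over.
  by rewrite big_delta mulr_sumr; apply: eq_bigr => t _; rewrite mulrA.
(* A word takes slice 0 to slice [|w|] with a factor [r^|w|] from [Z], and [T] contributes another
   [r^|w|] on that slice, whence the coefficient [(r^2)^|w|]. *)
have key : (f n X *m T - T *m f P Z') *m G = k *: (f n X -
    \sum_(w : N.-bseq 'I_d) (c w * (z ^+ 2) ^+ size w) *: \prod_(j <- w) Y j).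
  rewrite mulmxBl -!mulmxA scalerBr; congr (_ - _).
    have -> : T *m G = k%:M; last by rewrite mul_mx_scalar.
    by apply/matrixP => i l; rewrite mxE FG !mxE e'K /= expr0 mulr1 mulr_natr.
  apply/matrixP => i l; rewrite mxE TF mxE summxE; congr (_ * _).
  under eq_bigr do rewrite mxE FG fZ summxE mulr_sumr.
  rewrite exchange_big /=; apply: eq_bigr => w _; rewrite [RHS]mxE.
  have wN : (size w < N.+1)%N by rewrite ltnS size_bseq.
  rewrite (bigD1 (Ordinal wN)) //= [X in _ + X]big1 => [|t tw].
    rewrite mxE (prod_ampliation w _ _ be ZE) !e'K /= add0n eqxx addr0 mulr1.
    rewrite expr2 exprMn; ring.
  rewrite mxE (prod_ampliation w _ _ be ZE) !e'K /= add0n (_ : _ == _ = false) ?mulr0 //.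
  by apply/negbTE; apply: contraNneq tw => h; apply/eqP/val_inj.
have Gv : l2norm (mxact G v) = l2norm v.
  congr Num.sqrt.
  have E a : mxact G v a = if (e a).2 == ord0 then v (e a).1 else 0.
    rewrite /mxact; under eq_bigr do rewrite mxE -mulnb natrM -mulrA.
    rewrite -mulr_sumr big_delta; case: eqP => _; by rewrite ?mul1r ?mul0r.
  under eq_bigr do rewrite E.
  rewrite (sum_pair_bij be (fun p => rnorm (if p.2 == ord0 then v p.1 else 0) ^+ 2)) /=.
  apply: eq_bigr => i _; rewrite (bigD1 ord0) //= big1 ?addr0 // => t /negbTE ->.
  by rewrite rnorm0 expr0n.
have hU : forall h, l2norm (mxact (block_mx (f n X) (f n X *m T - T *m f P Z') 0 (f P Z')) h)
    <= M * l2norm h by move=> h; rewrite -fU; exact: hM.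
(* The corner of [f(U)] has norm at most [M]; division by [k] turns this into [M r^(N+1) / s]. *)
have := l2norm_mxact_ursub (mxact G v) hU M0.
have k0 : 0 < s / r ^+ N.+1 by rewrite divr_gt0 ?exprn_gt0.
rewrite Gv -mxactM key mxactZl l2normZ rnorm_real; last exact: ltW.
rewrite -ler_pdivlMl // => h; apply: le_trans h _.
by rewrite invf_div mulrCA mulrA.
Qed.

(** The length [N] and the coefficients found on nilpotent tuples depend on neither [Y] nor its
    size, so one polynomial serves all levels. *)
Lemma Hinf_dilation_approx (f : graded (op_ball Q)) (r e : R) :
  @Hinf R d (op_ball Q) f -> 0 < r -> r < 1 -> 0 < e ->
  exists p : freepoly R d, forall n (Y : mxtuple R d n) (X : op_ball Q n),
    (forall h, l2norm (tensor_eval Q Y h) <= l2norm h) ->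
    (forall j, \val X j = (r%:C%C ^+ 2) *: Y j) ->
    forall v, l2norm (mxact (f n X - polyval p Y) v) <= e * l2norm v.
Proof.
move=> [fnc /sup_norm_fin[M M0 hM]] r0 r1 e0.
pose s := Num.sqrt (1 - r ^+ 2).
have s0 : 0 < s by rewrite sqrtr_gt0 subr_gt0 expr_lt1 // ltW.
have [N hN] : exists N, M * (r ^+ N.+1 / s) <= e.
  (* The denominator is [M + 1] so that [M = 0] is allowed. *)
  have /cvgrPdist_lt/(_ (e * s / (M + 1))) : r ^+ n @[n --> \oo] --> 0.
    by apply: cvg_expr; rewrite ger0_norm // ltW.
  rewrite divr_gt0 ?mulr_gt0 ?ltr_wpDl // => /(_ isT)[N _ hN].
  exists N; have /ltW := hN N.+1 (leqnSn N).
  rewrite sub0r normrN ger0_norm ?exprn_ge0 ?(ltW r0) // ler_pdivlMr ?ltr_wpDl // => h.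
  rewrite mulrA ler_pdivrMr // mulrC; apply: le_trans h.
  by rewrite ler_wpM2l ?exprn_ge0 ?(ltW r0) // lerDl.
have [c hc] := nc_fun_nilpotent Qcont N fnc.
have [p hp] := polyval_sum_words
  (fun w : N.-bseq 'I_d => c w * (r%:C%C ^+ 2) ^+ size w) (fun w => w).
exists p => n Y X hY hX v; rewrite hp.
apply: le_trans (dilation_gap fnc M0 hM hc r0 r1 hY hX v) _.
by rewrite ler_wpM2r ?l2norm_ge0.
Qed.
End DilationApprox.

(** * Finite-dimensional compressions *)

Section GramSchmidt.
Context {R : realType} {E : hilbertType (Cplx R)}.
Local Notation C := (Cplx R).
Implicit Types (x y : E) (e : nat -> E).

Lemma hdot_rnorm x : hdot x x = (rnorm x ^+ 2)%:C%C.
Proof. by rewrite rmorphXn /= rnormE hdotE. Qed.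

Lemma hdot_eq0C x y : hdot x y = 0 -> hdot y x = 0.
Proof. by move=> xy; apply/eqP; rewrite herm_eq0C; apply/eqP. Qed.

Lemma rnorm_pythagoras x y : hdot x y = 0 ->
  rnorm (x + y) ^+ 2 = rnorm x ^+ 2 + rnorm y ^+ 2.
Proof.
by move=> xy; apply: (@complexI R); rewrite rmorphD /= -!hdot_rnorm hnormDd.
Qed.

(* Zero vectors are allowed, so that a family can be padded to any length. *)
Definition ortho_family e : Prop :=
  (forall a b, a != b -> hdot (e a) (e b) = 0) /\
  (forall a, e a = 0 \/ hdot (e a) (e a) = 1).

Definition ortho_proj e m x : E := \sum_(a < m) hdot x (e a) *: e a.

Lemma hdot_suml m (c : nat -> C) e y :
  hdot (\sum_(a < m) c a *: e a) y = \sum_(a < m) c a * hdot (e a) y.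
Proof. by rewrite linear_sumlz; apply: eq_bigr => a _; rewrite linearZl_LR. Qed.

Lemma ortho_coord e m (c : nat -> C) b : ortho_family e -> (b < m)%N ->
  hdot (\sum_(a < m) c a *: e a) (e b) = c b * hdot (e b) (e b).
Proof.
move=> [eo _] bm; rewrite hdot_suml (bigD1 (Ordinal bm)) //= big1 ?addr0 //.
by move=> a ab; rewrite eo ?mulr0.
Qed.

Lemma ortho_proj_coord e m x b : ortho_family e -> (b < m)%N ->
  hdot (ortho_proj e m x) (e b) = hdot x (e b).
Proof.
move=> ef bm; rewrite /ortho_proj (ortho_coord (fun a => hdot x (e a))) //.
by have [->|->] := ef.2 b; rewrite ?linear0r ?mul0r ?mulr1.
Qed.

Lemma ortho_proj_res e m x (c : nat -> C) : ortho_family e ->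
  hdot (x - ortho_proj e m x) (\sum_(a < m) c a *: e a) = 0.
Proof.
move=> ef; apply: hdot_eq0C; rewrite hdot_suml big1 // => a _.
rewrite [hdot _ _]hdot_eq0C ?mulr0 // linearBl /= ortho_proj_coord //.
exact: subrr.
Qed.

Lemma rnorm_ortho_sum e m (c : nat -> C) : ortho_family e ->
  rnorm (\sum_(a < m) c a *: e a) ^+ 2 =
  \sum_(a < m) rnorm (c a : C^o) ^+ 2 * rnorm (e a) ^+ 2.
Proof.
move=> ef; elim: m => [|m IH]; first by rewrite !big_ord0 rnorm0 expr0n.
rewrite !big_ord_recr /= rnorm_pythagoras ?IH ?rnormZ ?exprMn //.
rewrite linearZr_LR /= hdot_suml big1 ?mulr0 // => a _.
by rewrite ef.1 ?mulr0 // ltn_eqF.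
Qed.

Lemma ortho_rnorm_le1 e a : ortho_family e -> rnorm (e a) ^+ 2 <= 1.
Proof.
move=> [_ /(_ a)[->|]]; first by rewrite rnorm0 expr0n.
by rewrite hdot_rnorm -[1]/(1%:C%C) => /(@complexI R) ->.
Qed.

Lemma rnorm_ortho_sum_le e m (c : nat -> C) : ortho_family e ->
  rnorm (\sum_(a < m) c a *: e a) ^+ 2 <= \sum_(a < m) rnorm (c a : C^o) ^+ 2.
Proof.
move=> ef; rewrite rnorm_ortho_sum //; apply: ler_sum => a _.
by rewrite ler_piMr ?sqr_ge0 // ortho_rnorm_le1.
Qed.

Lemma bessel e m x : ortho_family e ->
  \sum_(a < m) rnorm (hdot x (e a) : C^o) ^+ 2 <= rnorm x ^+ 2.
Proof.
move=> ef; rewrite -{2}(subrK (ortho_proj e m x) x).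
rewrite rnorm_pythagoras; last exact: (ortho_proj_res m x (fun a => hdot x (e a)) ef).
rewrite /ortho_proj (rnorm_ortho_sum m (fun a => hdot x (e a)) ef) // ler_wpDl ?sqr_ge0 //.
apply: ler_sum => a _; have [->|] := ef.2 a.
  by rewrite linear0r rnorm0 expr0n mul0r.
by rewrite hdot_rnorm -[1]/(1%:C%C) => /(@complexI R) ->; rewrite mulr1.
Qed.

(** Validity for every [m] from [size hs] on lets two families of different lengths be cut at a
    common [m], which makes the compressions square. *)
Lemma gram_schmidt (hs : seq E) : exists e, ortho_family e /\
  forall m h, (size hs <= m)%N -> h \in hs -> h = ortho_proj e m h.
Proof.
(* For the induction [e] vanishes from position [size hs] on. The next vector goes there: the
   normalised remainder, or zero if nothing remains. *)
suff [e [ef e0 eh]] : exists e, [/\ ortho_family e,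
    forall a, (size hs <= a)%N -> e a = 0 &
    forall h, h \in hs -> h = ortho_proj e (size hs) h].
  exists e; split=> // m h hm /eh {1}->; rewrite /ortho_proj.
  rewrite -(subnKC hm) big_split_ord /= [X in _ + X]big1 ?addr0 // => i _.
  by rewrite e0 ?scaler0 // leq_addr.
elim/last_ind: hs => [|hs x [e [ef e0 eh]]].
  by exists (fun=> 0); split=> //; split=> [a b _|a]; [rewrite linear0l|left].
set p := size hs in e0 eh *; pose r := x - ortho_proj e p x.
pose u : E := if r == 0 then 0 else (rnorm r)^-1%:C%C *: r.
have rE : r = hdot r u *: u.
  rewrite /u; case: eqP => [->|/eqP r0]; first by rewrite scaler0.
  have n0 : rnorm r != 0 by apply: contraNneq r0 => /rnorm_eq0 ->.
  rewrite linearZr_LR /= hdot_rnorm scalerA.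
  rewrite [Num.conj _](_ : _ = (rnorm r)^-1%:C%C); last first.
    by rewrite -[LHS]/(conjc _) /= oppr0.
  rewrite -!rmorphM /= [X in X%:C%C](_ : _ = 1) ?scale1r //.
  by rewrite mulrAC -expr2 -exprMn mulVf ?expr1n.
have eu a : hdot (e a) u = 0.
  rewrite /u; case: eqP => _; first by rewrite linear0r.
  rewrite linearZr_LR /= (_ : hdot _ _ = 0) ?mulr0 //; apply: hdot_eq0C.
  have [ap|pa] := ltnP a p; last by rewrite e0 // linear0r.
  by rewrite linearBl /= ortho_proj_coord //; exact: subrr.
have ue a : hdot u (e a) = 0 by exact: hdot_eq0C.
have uf : u = 0 \/ hdot u u = 1.
  rewrite /u; case: eqP => [_|/eqP r0]; [by left|right].
  have n0 : rnorm r != 0 by apply: contraNneq r0 => /rnorm_eq0 ->.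
  rewrite hdot_rnorm rnormZ rnorm_real ?invr_ge0 ?rnorm_ge0 //.
  by rewrite mulVf // expr1n.
pose e' a := if a == p then u else e a.
have e'p : e' p = u by rewrite /e' eqxx.
have e'n (a : 'I_p) : e' a = e a by rewrite /e' ltn_eqF.
exists e'; split; first split.
- move=> a b ab; rewrite /e'; case: (eqVneq a p) ab => [->|_]; case: (eqVneq b p) => // _ ab.
  exact: ef.1.
- by move=> a; rewrite /e'; case: eqP => _; [exact: uf|exact: ef.2].
- move=> a; rewrite size_rcons => pa; rewrite /e' gtn_eqF // e0 //; exact: ltnW.
move=> h; rewrite size_rcons mem_rcons in_cons /ortho_proj big_ord_recr /= e'p.
under eq_bigr do rewrite e'n.
rewrite -/(ortho_proj e p h) => /orP[/eqP ->|/eh hE].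
  rewrite -[LHS](subrK (ortho_proj e p x)) addrC -/r {1}rE; congr (_ *: _ + _).
  by rewrite /r linearBl /= (hdot_suml p (fun a => hdot x (e a))) big1 ?subr0 // => a _; rewrite eu mulr0.
rewrite -hE {3}hE (hdot_suml p (fun a => hdot h (e a))) big1 ?scale0r ?addr0 // => a _.
by rewrite eu mulr0.
Qed.

End GramSchmidt.

Section BlockNorm.
Context {R : realType}.
Local Notation C := (Cplx R).

(** An index of [\mxblock] is a number encoding a pair; decoding it by [tagnat] turns the norm into
    sums over pairs. *)
Lemma mxblock_normP m l (B : 'I_m -> 'I_m -> 'M[C]_l) (c : R) : 0 <= c ->
  (mxnorm (\mxblock_(j < m, k < m) B j k) <= c%:E)%E <->
  forall x : 'I_m -> 'I_l -> C^o,
    \sum_j \sum_i rnorm (\sum_k mxact (B j k) (x k) i) ^+ 2 <=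
    c ^+ 2 * \sum_k \sum_i rnorm (x k i) ^+ 2.
Proof.
move=> c0.
pose e (s : 'I_(\sum_(j < m) l)) : 'I_m * 'I_l := (tagnat.sig1 s, tagnat.sig2 s).
have be : bijective e.
  exists (fun p => @tagnat.Rank m (fun=> l) p.1 p.2) => [s|[j i]].
    exact: tagnat.sig2K.
  rewrite /e /= tagnat.Rank1K tagnat.Rank2K; congr (_, _); exact: val_inj.
case: (be) => e' eK e'K.
have act h s : mxact (\mxblock_(j < m, k < m) B j k) h s =
    \sum_k mxact (B (e s).1 k) (fun i => h (e' (k, i))) (e s).2.
  transitivity (\sum_t (fun p => B (tagnat.sig1 s) p.1 (tagnat.sig2 s) p.2 * h (e' p)) (e t)).
    by apply: eq_bigr => t _; rewrite eK mxE.
  exact: (sum_pair_bij be (fun p => B (tagnat.sig1 s) p.1 (tagnat.sig2 s) p.2 * h (e' p))).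
have E (x : 'I_m -> 'I_l -> C^o) :
    \sum_s rnorm (x (e s).1 (e s).2) ^+ 2 = \sum_k \sum_i rnorm (x k i) ^+ 2.
  exact: (sum_pair_bij be (fun p => rnorm (x p.1 p.2) ^+ 2)).
split=> [/(mxnormP _ c0) H x|H].
  have := H (fun s => x (e s).1 (e s).2); rewrite l2norm_le_scale // E.
  apply: le_trans; rewrite le_eqVlt; apply/orP; left; apply/eqP.
  rewrite -E; apply: eq_bigr => s _; rewrite act; congr (rnorm _ ^+ 2).
  apply: eq_bigr => k _; congr (mxact _ _ _); apply/funext => i.
  by rewrite e'K.
apply/mxnormP => // h; rewrite l2norm_le_scale //.
have := H (fun k i => h (e' (k, i))); rewrite -!E.
under [X in _ <= _ * X -> _]eq_bigr do rewrite -surjective_pairing eK.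
by apply: le_trans; apply: ler_sum => s _; rewrite act.
Qed.

End BlockNorm.

Section Coefficients.
Context {R : realType} {d : nat} {H K : hilbertType (Cplx R)}.
Local Notation C := (Cplx R).
Variable Q : 'I_d -> {linear H -> K}.

(** The coefficients of [Q(Y)] between [e a] and [g] are linear combinations of the [Y j], hence
    become elements of [A(V)] when the coordinates are put for [Y]. *)
Lemma hdot_tensor_eval n m (Y : mxtuple R d n) (c : 'I_m -> 'I_n.+1 -> C^o)
    (e : nat -> H) (g : K) i :
  hdot (tensor_eval Q Y (fun k => \sum_(a < m) c a k *: e a) i) g =
  \sum_(a < m) mxact (\sum_j hdot (Q j (e a)) g *: Y j) (c a) i.
Proof.
rewrite /tensor_eval linear_sumlz.
transitivity (\sum_j \sum_k \sum_(a < m) Y j i k * (c a k * hdot (Q j (e a)) g)).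
  apply: eq_bigr => j _; rewrite linear_sumlz; apply: eq_bigr => k _.
  rewrite linearZl_LR linear_sum linear_sumlz mulr_sumr; apply: eq_bigr => a _.
  by rewrite linearZ linearZl_LR.
under eq_bigr do rewrite exchange_big.
rewrite exchange_big; apply: eq_bigr => a _; rewrite exchange_big /mxact.
apply: eq_bigr => k _; rewrite summxE mulr_suml; apply: eq_bigr => j _ /=.
by rewrite mxE [_ * Y _ _ _]mulrC -mulrA [c _ _ * _]mulrC.
Qed.

(* The blocks are those of the compression of [Q(Y)] to the spans of the
   [e a] and of the [g b]. *)
Lemma compression_le n m (Y : mxtuple R d n) (e : nat -> H) (g : nat -> K) :
  ortho_family e -> ortho_family g ->
  (forall h, l2norm (tensor_eval Q Y h) <= l2norm h) ->
  forall x : 'I_m -> 'I_n.+1 -> C^o,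
    \sum_(b < m) \sum_i rnorm (\sum_(a < m)
      mxact (\sum_j hdot (Q j (e a)) (g b) *: Y j) (x a) i) ^+ 2 <=
    1 ^+ 2 * \sum_a \sum_i rnorm (x a i) ^+ 2.
Proof.
move=> ef gf hY x; rewrite exchange_big /= expr1n mul1r.
under eq_bigr do under eq_bigr do rewrite -hdot_tensor_eval.
pose h (k : 'I_n.+1) : H := \sum_(a < m) x a k *: e a.
apply: (@le_trans _ _ (\sum_i rnorm (tensor_eval Q Y h i) ^+ 2)).
  by apply: ler_sum => i _; exact: bessel.
have := hY h; rewrite -[l2norm h]mul1r l2norm_le_scale // expr1n mul1r.
move=> /le_trans; apply; rewrite [leRHS]exchange_big /=.
(* [insub] extends [x] to [nat]; the default 0 is never met, as only [a < m] occurs. *)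
apply: ler_sum => k _; pose c a : C := if insub a is Some a' then x a' k else 0.
have := rnorm_ortho_sum_le m c ef.
rewrite (eq_bigr (fun a : 'I_m => x a k *: e a)) => [|a _]; last by rewrite /c valK.
move=> /le_trans; apply; apply: ler_sum => a _; by rewrite /c valK.
Qed.

(** At a fixed [h] only finitely many vectors matter: the components of [h], and the images under
    the [Q j] of vectors spanning them. A compression to spans containing these is exact at [h]. *)
Lemma tensor_le_of_compressions n (X : mxtuple R d n) :
  (forall m (e : nat -> H) (g : nat -> K), ortho_family e -> ortho_family g ->
     forall x : 'I_m -> 'I_n.+1 -> C^o,
     \sum_(b < m) \sum_i rnorm (\sum_(a < m)
       mxact (\sum_j hdot (Q j (e a)) (g b) *: X j) (x a) i) ^+ 2 <=
     1 ^+ 2 * \sum_a \sum_i rnorm (x a i) ^+ 2) ->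
  forall h, l2norm (tensor_eval Q X h) <= l2norm h.
Proof.
move=> hX h; have [e [ef he]] := gram_schmidt [seq h k | k : 'I_n.+1].
pose p := size [seq h k | k : 'I_n.+1].
have [g [gf hg]] := gram_schmidt [seq Q j (e a) | j <- enum 'I_d, a <- iota 0 p].
pose q := size [seq Q j (e a) | j <- enum 'I_d, a <- iota 0 p].
pose m := maxn p q.
have hE k : h k = \sum_(a < p) hdot (h k) (e a) *: e a.
  by apply: he => //; apply/mapP; exists k; rewrite ?mem_enum.
have hE' : h = fun k => \sum_(a < m) hdot (h k) (e a) *: e a.
  apply/funext => k; apply: he; first exact: leq_maxl.
  by apply/mapP; exists k; rewrite ?mem_enum.
(* The fixed points of the projection form a subspace containing all [Q j (e a)] with [a < p], hence
   every component of [Q(X) h]. *)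
have tE i : tensor_eval Q X h i = ortho_proj g m (tensor_eval Q X h i).
  have PL : linear (ortho_proj g m).
    move=> a u v; rewrite /ortho_proj scaler_sumr -big_split /=; apply: eq_bigr => b _.
    by rewrite linearPl scalerDl scalerA.
  have P0 : ortho_proj g m 0 = 0 by rewrite -[0 in LHS](subrr 0) -scaleN1r addrC PL scaleN1r addNr.
  have PZ a y : y = ortho_proj g m y -> a *: y = ortho_proj g m (a *: y).
    by move=> yE; rewrite -[a *: y]addr0 PL P0 -yE.
  have PS (I : finType) (F : I -> K) : (forall l, F l = ortho_proj g m (F l)) ->
      \sum_l F l = ortho_proj g m (\sum_l F l).
    move=> hF; elim: (index_enum I) => [|l s IH]; first by rewrite !big_nil P0.
    by rewrite !big_cons -[F l]scale1r PL -IH -hF.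
  rewrite /tensor_eval; apply: (PS) => j; apply: (PS) => k; apply: (PZ).
  rewrite hE linear_sum; apply: (PS) => a; rewrite linearZ; apply: (PZ).
  apply: hg; first exact: leq_maxr.
  by apply/allpairsP; exists (j, val a); rewrite mem_enum mem_iota /= ltn_ord.
have := hX m e g ef gf (fun a k => hdot (h k) (e a)).
rewrite expr1n mul1r exchange_big /= => H1.
rewrite -[l2norm h]mul1r l2norm_le_scale // expr1n mul1r.
apply: (@le_trans _ _ (\sum_i \sum_(b < m) rnorm (hdot (tensor_eval Q X h i) (g b) : C^o) ^+ 2)).
  apply: ler_sum => i _; rewrite {1}tE.
  exact: (rnorm_ortho_sum_le m (fun b => hdot (tensor_eval Q X h i) (g b)) gf).
apply: le_trans (_ : _ <= \sum_(a < m) \sum_k rnorm (hdot (h k) (e a) : C^o) ^+ 2) _.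
  apply: le_trans H1; apply: ler_sum => i _; apply: ler_sum => b _.
  by rewrite -hdot_tensor_eval -hE'.
rewrite exchange_big /=; apply: ler_sum => k _; exact: bessel.
Qed.

End Coefficients.

(** * Completely contractive representations *)

Section Representation.
Context {R : realType} {d : nat} {H K : hilbertType (Cplx R)}.
Local Notation C := (Cplx R).
Context {Q : 'I_d -> {linear H -> K}} {V : nc_set R d}.
Variables (Qfree : lin_indep Q) (Vsub : subvariety Q V).
Arguments V : clear implicits.
Local Notation Z := (coord_elt V Qfree Vsub).

(** Built from the coordinates inside [A_alg V], so that multiplicativity of a representation
    applies to it. *)
Definition poly_elt (p : freepoly R d) : A_alg V :=
  \sum_(w <- finmap.enum_fset (msupp p)) mcoeff w p *: \prod_(j <- (w : seq 'I_d)) Z j.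

Lemma val_poly_elt p n (Y : V n) : val (poly_elt p) n Y = polyval p (\val Y).
Proof.
rewrite /polyval mmapE /poly_elt raddf_sum /=.
have sumE (I : Type) (s : seq I) (F : I -> graded V) :
    (\sum_(i <- s) F i) n Y = \sum_(i <- s) F i n Y.
  by elim: s => [|i s IH]; rewrite ?big_nil // !big_cons -IH.
rewrite sumE; apply: eq_bigr => w _.
rewrite -[scalar_mx _ * _]/(_ *m _) mul_scalar_mx.
rewrite -[LHS]/(_ *: (val (\prod_(j <- (w : seq 'I_d)) Z j) n Y)); congr (_ *: _).
rewrite /wordval; elim: (w : seq _) => [|j s IH]; first by rewrite !big_nil.
by rewrite !big_cons -IH.
Qed.

Section Contractive.
Variables (n : nat) (Phi : rep_space V n).
Hypothesis Phicc : Rep_cc V n Phi.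

Lemma rep0 : Phi 0 = 0.
Proof.
have [Phil _ _] := Phicc.
by rewrite -[0 in LHS](subrr (0 : A_alg V)) -scaleN1r addrC Phil scaleN1r addNr.
Qed.

Lemma rep_poly_elt p : Phi (poly_elt p) = polyval p (rep_pi V Qfree Vsub n Phi).
Proof.
have [Phil [Phi1 PhiM] _] := Phicc.
have Phi0 := rep0.
rewrite /polyval mmapE /poly_elt; elim: (finmap.enum_fset (msupp p)) => [|w s IH].
  by rewrite !big_nil.
rewrite !big_cons Phil IH; congr (_ + _).
rewrite -[scalar_mx _ * _]/(_ *m _) mul_scalar_mx; congr (_ *: _).
rewrite /wordval; elim: (w : seq _) => [|j u IHu]; first by rewrite !big_nil.
by rewrite !big_cons PhiM IHu.
Qed.

(** Complete contractivity with the norms written as sums of squares, so that a bound on [V] passes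
    to [Phi] without extended reals. *)
Lemma rep_block_le m (F : 'M[A_alg V]_m) (c : R) : 0 <= c ->
  (forall l (Y : V l) (x : 'I_m -> 'I_l.+1 -> C^o),
     \sum_j \sum_i rnorm (\sum_k mxact (val (F j k) l Y) (x k) i) ^+ 2 <=
     c ^+ 2 * \sum_k \sum_i rnorm (x k i) ^+ 2) ->
  forall x : 'I_m -> 'I_n.+1 -> C^o,
    \sum_j \sum_i rnorm (\sum_k mxact (Phi (F j k)) (x k) i) ^+ 2 <=
    c ^+ 2 * \sum_k \sum_i rnorm (x k i) ^+ 2.
Proof.
have [_ _ Phic] := Phicc => c0 hF; apply/mxblock_normP => //.
apply: le_trans (Phic m F) _; apply: ge_ereal_sup => _ [->|[l [Y ->]]].
  by rewrite lee_fin.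
apply/mxblock_normP => // x.
under eq_bigr do under eq_bigr do under eq_bigr do rewrite mxE.
exact: hF.
Qed.

Lemma rep_le (a : A_alg V) (c : R) : 0 <= c ->
  (forall l (Y : V l) h, l2norm (mxact (val a l Y) h) <= c * l2norm h) ->
  forall h, l2norm (mxact (Phi a) h) <= c * l2norm h.
Proof.
move=> c0 ha h; rewrite l2norm_le_scale //.
have := @rep_block_le 1 (const_mx a) c c0.
move=> /(_ _ (fun=> h)); rewrite !big_ord1.
under eq_bigr do rewrite big_ord1 mxE.
apply=> l Y x; rewrite !big_ord1.
under eq_bigr do rewrite big_ord1 mxE.
by rewrite -l2norm_le_scale.
Qed.

Lemma subvariety_op_ball l (Y : mxtuple R d l) : V l Y -> op_ball Q l Y.
Proof. by have [S _ VS] := Vsub; rewrite VS => -[X _ <-]; exact: set_mem (valP X). Qed.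

(** The compressions of [Q(Z)] are matrices over [A(V)] of norm at most 1, because [V] lies in the
    ball. By linearity [Phi] sends them to the same compressions of [Q] at the image of the
    coordinates. *)
Lemma rep_pi_ball h :
  l2norm (tensor_eval Q (rep_pi V Qfree Vsub n Phi) h) <= l2norm h.
Proof.
apply: tensor_le_of_compressions => m e g ef gf x.
pose F : 'M[A_alg V]_m := \matrix_(b, a) \sum_j hdot (Q j (e a)) (g b) *: Z j.
have [Phil _ _] := Phicc.
have PhiF b a : Phi (F b a) =
    \sum_j hdot (Q j (e a)) (g b) *: rep_pi V Qfree Vsub n Phi j.
  rewrite mxE /rep_pi.
  have Phi0 := rep0.
  by elim: (index_enum _) => [|j s IH]; rewrite ?big_nil // !big_cons Phil IH.
under eq_bigr do under eq_bigr do under eq_bigr do rewrite -PhiF.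
apply: rep_block_le => // l Y y.
have FY b a : val (F b a) l Y = \sum_j hdot (Q j (e a)) (g b) *: \val Y j.
  by rewrite mxE; elim: (index_enum _) => [|j s IH]; rewrite ?big_nil // !big_cons -IH.
under eq_bigr do under eq_bigr do under eq_bigr do rewrite FY.
apply: compression_le => // k.
have /op_ballP[c [c0 c1 hc]] := subvariety_op_ball (set_mem (valP Y)).
by apply: le_trans (hc k) _; rewrite ler_piMl ?l2norm_ge0 // ltW.
Qed.

End Contractive.
End Representation.

(** * Convergence of matrices *)

Section PointwiseTopology.
Context {I : Type} {U : topologicalType}.

Lemma cvg_ptws (T : Type) (F : set_system T) (FF : Filter F)
    (g : T -> {ptws I -> U}) (l : {ptws I -> U}) :
  (forall i, g x i @[x --> F] --> l i) -> g @ F --> l.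
Proof.
move=> gl; apply/cvg_sup => i A; rewrite nbhsE => -[B [Bop Bl] BA].
have [W Wop WB] := Bop.
have FW : F [set x | W (g x i)].
  by apply: (gl i); apply: open_nbhs_nbhs; split=> //; move: Bl; rewrite -WB.
have : (g @ F) A by apply: filterS FW => x Wx; apply: BA; rewrite -WB; exact: Wx.
by [].
Qed.

Lemma cvg_proj (l : {ptws I -> U}) i :
  (g i : U) @[g --> nbhs l] --> l i.
Proof.
have /cvg_sup/(_ i) h : l --> l by exact: cvg_id.
move=> A /(@initial_continuous _ _ (fun g : I -> U => g i) l) lA.
exact: h.
Qed.

End PointwiseTopology.

Section MatrixConvergence.
Context {R : realType}.
Local Notation C := (Cplx R).

Lemma cvg_rnormP (E : normedModType C) (T : Type) (F : set_system T)
    (FF : Filter F) (g : T -> E) (l : E) :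
  g @ F --> l <-> forall e : R, 0 < e -> \forall x \near F, rnorm (l - g x) < e.
Proof.
split=> [/cvgrPdist_lt gl e e0|gl].
  have := gl e%:C%C; rewrite -[0]/(0%:C%C) ltcR => /(_ e0).
  by apply: filterS => x; rewrite -rnormE ltcR.
apply/cvgrPdist_lt => e e0; have eE : e = (rnorm (e : C^o))%:C%C.
  by rewrite rnormE gtr0_norm.
have := gl (rnorm (e : C^o)); rewrite -ltcR -eE => /(_ e0).
by apply: filterS => x; rewrite -ltcR -eE rnormE.
Qed.

Lemma cvg_mxP m n (T : Type) (F : set_system T) (FF : Filter F)
    (g : T -> 'M[C]_(m, n)) (A : 'M[C]_(m, n)) :
  g @ F --> A <-> forall i j, g x i j @[x --> F] --> A i j.
Proof.
split=> [gA i j P PA|gA P [Q QA QP]].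
  apply: (gA [set B : 'M[C]_(m, n) | P (B i j)]).
  exists (fun i' j' => if (i' == i) && (j' == j) then P else setT).
    by move=> i' j'; case: ifP => [/andP[/eqP -> /eqP ->] //|_]; exact: filterT.
  by move=> B /(_ i j); rewrite !eqxx.
have h : \forall x \near F, forall ij : 'I_m * 'I_n, Q ij.1 ij.2 (g x ij.1 ij.2).
  by apply: filter_forall => -[i j]; exact: gA.
by apply: filterS h => x h; apply: QP => i j; exact: (h (i, j)).
Qed.

Lemma rnorm_entry_le m n (A : 'M[C]_(m, n)) (e : R) i k :
  (forall h, l2norm (mxact A h) <= e * l2norm h) -> rnorm (A i k : C^o) <= e.
Proof.
move=> /(_ (fun l => (k == l)%:R)).
have -> : mxact A (fun l => (k == l)%:R : C^o) = fun i => A i k.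
  by apply/funext => j; rewrite /mxact; under eq_bigr do rewrite mulrC; rewrite big_delta.
have -> : l2norm (fun l => (k == l)%:R : C^o) = 1.
  rewrite /l2norm (bigD1 k) //= eqxx big1 => [|l lk].
    by rewrite addr0 /rnorm normr1 /= expr1n sqrtr1.
  by rewrite eq_sym (negbTE lk) rnorm0 expr0n.
by rewrite mulr1; apply: le_trans; exact: (rnorm_le_l2norm (fun j => A j k : C^o)).
Qed.

Lemma l2norm_entries_le m n (A : 'M[C]_(m, n)) h :
  l2norm (mxact A h) <= (\sum_i \sum_k rnorm (A i k : C^o)) * l2norm h.
Proof.
apply: le_trans (l2norm_le_sum _) _; rewrite mulr_suml; apply: ler_sum => i _.
apply: le_trans (ler_rnorm_sum _ _ _) _; rewrite mulr_suml; apply: ler_sum => k _.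
by rewrite [X in rnorm X]/(A i k *: h k) rnormZ ler_wpM2l ?rnorm_ge0 // rnorm_le_l2norm.
Qed.

(** An entry is at most the operator norm, which is at most the sum of all entries in modulus; so
    entrywise and norm convergence agree. *)
Lemma cvg_opnormP m n (T : Type) (F : set_system T) (FF : Filter F)
    (g : T -> 'M[C]_(m, n)) (A : 'M[C]_(m, n)) :
  g @ F --> A <-> forall e : R, 0 < e ->
    \forall x \near F, forall h, l2norm (mxact (A - g x) h) <= e * l2norm h.
Proof.
split=> [/cvg_mxP gA e e0|gA].
  have b0 : 0 < (m * n).+1%:R :> R by [].
  have h : \forall x \near F, forall ij : 'I_m * 'I_n,
      rnorm (A ij.1 ij.2 - g x ij.1 ij.2 : C^o) < e / (m * n).+1%:R.
    apply: filter_forall => -[i j].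
    by have /(@cvg_rnormP C^o) := gA i j; apply; rewrite divr_gt0.
  apply: filterS h => x hx h; apply: le_trans (l2norm_entries_le _ _) _.
  rewrite ler_wpM2r ?l2norm_ge0 //.
  apply: (@le_trans _ _ (\sum_(i < m) \sum_(k < n) e / (m * n).+1%:R)).
    apply: ler_sum => i _; apply: ler_sum => k _; rewrite !mxE ltW //.
    exact: (hx (i, k)).
  rewrite !sumr_const !card_ord -mulrnA -[leLHS]mulr_natr -mulrA ler_piMr ?(ltW e0) //.
  by rewrite mulrC ler_pdivrMr // mul1r ler_nat mulnC.
apply/cvg_mxP => i j; apply/(@cvg_rnormP C^o) => e e0.
have e2 : 0 < e / 2 by rewrite divr_gt0.
apply: filterS (gA _ e2) => x /(rnorm_entry_le i j); rewrite !mxE => h.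
by apply: le_lt_trans h _; rewrite ltr_pdivrMr // ltr_pMr // ltr1n.
Qed.

Lemma cvg_mulmx m n p (T : Type) (F : set_system T) (FF : Filter F)
    (f : T -> 'M[C]_(m, n)) (g : T -> 'M[C]_(n, p))
    (A : 'M[C]_(m, n)) (B : 'M[C]_(n, p)) :
  f @ F --> A -> g @ F --> B -> (f x *m g x) @[x --> F] --> A *m B.
Proof.
move=> /cvg_mxP fA /cvg_mxP gB; apply/cvg_mxP => i k.
rewrite mxE (_ : (fun x => (f x *m g x) i k) = fun x => \sum_j f x i j * g x j k); last first.
  by apply/funext => x; rewrite mxE.
elim: (index_enum _) => [|j s IH].
  by rewrite big_nil; under eq_fun do rewrite big_nil; exact: cvg_cst.
rewrite big_cons; under eq_fun do rewrite big_cons.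
by apply: cvgD IH; exact: cvgM.
Qed.

(** Real and imaginary parts satisfy the Cauchy criterion. Its form, a constant eventually within
    [e], is the one that polynomial approximation delivers. *)
Lemma cvg_cplx (T : Type) (F : set_system T) (FF : ProperFilter F) (u : T -> C) :
  (forall e : R, 0 < e ->
     exists a : C, \forall x \near F, rnorm (u x - a : C^o) <= e) ->
  exists l : C, u @ F --> l.
Proof.
move=> uC.
have part (f : C -> R) : (forall a b, `|f a - f b| <= rnorm (a - b : C^o)) ->
    exists l : R, f (u x) @[x --> F] --> l.
  move=> hf; apply/cvg_ex/cauchy_cvgP/cauchy_exP => e e0.
  have [|a ha] := uC (e / 2); first by rewrite divr_gt0.
  exists (f a); apply: filterS ha => x xa; rewrite /ball /= distrC.
  apply: le_lt_trans (hf _ _) _; apply: le_lt_trans xa _.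
  by rewrite ltr_pdivrMr // ltr_pMr // ltr1n.
have rnormE2 (z : C) : rnorm (z : C^o) =
    Num.sqrt (complex.Re z ^+ 2 + complex.Im z ^+ 2) by case: z.
have re (z : C) : `|complex.Re z| <= rnorm (z : C^o).
  by rewrite rnormE2 -sqrtr_sqr ler_wsqrtr // lerDl sqr_ge0.
have im (z : C) : `|complex.Im z| <= rnorm (z : C^o).
  by rewrite rnormE2 -sqrtr_sqr ler_wsqrtr // lerDr sqr_ge0.
have le (z : C) : rnorm (z : C^o) <= `|complex.Re z| + `|complex.Im z|.
  rewrite rnormE2 -[leRHS]ger0_norm ?addr_ge0 // -[leRHS]sqrtr_sqr ler_wsqrtr //.
  rewrite sqrrD !real_normK ?num_real // -addrA lerD2l lerDr.
  by rewrite mulrn_wge0 // mulr_ge0.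
have [|x xl] := part (@complex.Re R); first by move=> a b; have := re (a - b); rewrite raddfB.
have [|y yl] := part (@complex.Im R); first by move=> a b; have := im (a - b); rewrite raddfB.
exists (complex.Complex x y); apply/(@cvg_rnormP C^o) => e e0.
have e2 : 0 < e / 2 by rewrite divr_gt0.
have /cvgrPdist_lt/(_ _ e2) hx := xl; have /cvgrPdist_lt/(_ _ e2) hy := yl.
near=> t; apply: le_lt_trans (le _) _; rewrite (splitr e) !raddfB /=.
apply: ltrD; [near: t; exact: hx|near: t; exact: hy].
Unshelve. all: by end_near. Qed.

End MatrixConvergence.

(** * Extension to the closure *)

Lemma ler_addgt0_mul (R : realFieldType) (x a l : R) : 0 <= l ->
  (forall t, 0 < t -> x <= (a + t) * l) -> x <= a * l.
Proof.
rewrite le_eqVlt => /orP[/eqP <- /(_ 1 ltr01)|l0 h]; first by rewrite !mulr0.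
rewrite -ler_pdivrMr //; apply/ler_addgt0Pr => t t0.
by rewrite ler_pdivrMr //; exact: h.
Qed.

Lemma opnorm_small_eq0 (R : realType) m n (A : 'M[Cplx R]_(m, n)) :
  (forall e : R, 0 < e -> forall h, l2norm (mxact A h) <= e * l2norm h) -> A = 0.
Proof.
move=> hA; apply/matrixP => i k; rewrite mxE; apply: (@rnorm_eq0 R (Cplx R)^o).
apply/eqP; rewrite eq_le rnorm_ge0 andbT; apply/ler_addgt0Pr => e e0.
by rewrite add0r; apply: rnorm_entry_le; exact: hA.
Qed.

Lemma opnorm_le_trans (R : realType) m n (A B D : 'M[Cplx R]_(m, n)) (a b : R) h :
  l2norm (mxact (A - B) h) <= a * l2norm h ->
  l2norm (mxact (B - D) h) <= b * l2norm h ->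
  l2norm (mxact (A - D) h) <= (a + b) * l2norm h.
Proof.
move=> hA hB; rewrite -(subrK B A) -addrA mxactD mulrDl.
by apply: le_trans (ler_l2normD _ _) _; exact: lerD.
Qed.

Lemma opnorm_sym (R : realType) m n (A B : 'M[Cplx R]_(m, n)) h :
  l2norm (mxact (A - B) h) = l2norm (mxact (B - A) h).
Proof.
by rewrite -opprB -scaleN1r mxactZl l2normZ /rnorm normrN1 mul1r.
Qed.

Lemma coord_cvg (R : realType) d n (X : mxtuple R d n) j :
  (Y j : 'M[Cplx R]_n.+1) @[Y --> X] --> X j.
Proof. exact: (@cvg_proj 'I_d 'M[Cplx R]_n.+1 X j). Qed.

Lemma polyval_cvg (R : realType) d n (p : freepoly R d) (X : mxtuple R d n) :
  polyval p Y @[Y --> X] --> polyval p X.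
Proof.
rewrite /polyval mmapE (_ : (fun Y => mmap scalar_mx (wordval Y) p) = fun Y =>
  \sum_(w <- finmap.enum_fset (msupp p)) scalar_mx (mcoeff w p) * wordval Y w); last first.
  by apply/funext => Y; rewrite mmapE.
elim: (finmap.enum_fset _) => [|w s IH].
  by rewrite big_nil; under eq_fun do rewrite big_nil; exact: (@cvg_cst _ (0 : 'M[Cplx R]_n.+1) _ (nbhs X)).
rewrite big_cons; under eq_fun do rewrite big_cons.
apply: cvgD IH; apply: cvg_mulmx; first exact: cvg_cst.
rewrite /wordval; elim: (w : seq _) => [|j u IHu].
  by rewrite big_nil; under eq_fun do rewrite big_nil; exact: cvg_cst.
rewrite big_cons; under eq_fun do rewrite big_cons.
by apply: cvg_mulmx IHu; exact: coord_cvg.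
Qed.

Section Extension.
Context {R : realType} {d : nat}.
Local Notation C := (Cplx R).
Variable V : nc_set R d.
Arguments V : clear implicits.
Variables (n : nat) (X : mxtuple R d n).
Hypothesis clX : closure (V n) X.

Lemma valL_in (f : graded V) Y (VY : V n Y) : 'valL_0 (f n) Y = f n (elt_of VY).
Proof.
rewrite /valL_ /= oinv_set_val /=; have YV : Y \in V n by exact: mem_set.
by rewrite insubT /=; congr (f n _); apply: val_inj.
Qed.

Lemma valL_out (f : graded V) Y : ~ V n Y -> 'valL_0 (f n) Y = 0.
Proof.
move=> VY; rewrite /valL_ /= oinv_set_val /= insubN //.
by apply/negP => /set_mem.
Qed.

Let PF : ProperFilter (within (V n) (nbhs X)) := within_nbhs_proper clX.

Lemma near_poly (p : freepoly R d) (e : R) : 0 < e ->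
  \forall Y \near within (V n) (nbhs X),
    forall h, l2norm (mxact (polyval p X - polyval p Y) h) <= e * l2norm h.
Proof.
move=> e0; have /cvg_opnormP/(_ _ e0) h := @polyval_cvg R d n p X.
exact: cvg_within h.
Qed.

(** On [V] near [X], [f] is within [e/2] of a polynomial [p], and [p] within [e/2] of [p(X)]; so the
    entries of [f] satisfy the Cauchy criterion around those of [p(X)]. *)
Lemma extend_cvg (f : graded V) : A_set f ->
  'valL_0 (f n) Y @[Y --> within (V n) (nbhs X)] --> extend f X.
Proof.
move=> /A_setP[_ _ fa].
have /choice[L hL] : forall ik : 'I_n.+1 * 'I_n.+1, exists l : C,
    ('valL_0 (f n) Y ik.1 ik.2) @[Y --> within (V n) (nbhs X)] --> l.
  move=> [i k]; apply: cvg_cplx => e e0.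
  have e2 : 0 < e / 2 by rewrite divr_gt0.
  have [p hp] := fa _ e2; exists (polyval p X i k).
  have near1 := near_poly p e2.
  have near2 : \forall Y \near within (V n) (nbhs X), V n Y by exact: withinT.
  apply: filterS2 near1 near2 => Y hY VY; rewrite (valL_in _ VY) /=.
  have := @rnorm_entry_le _ _ _ (f n (elt_of VY) - polyval p X) e i k.
  rewrite !mxE; apply => h; rewrite (splitr e).
  by apply: opnorm_le_trans (hp _ _ h) _; rewrite opnorm_sym; exact: hY.
have cL : 'valL_0 (f n) Y @[Y --> within (V n) (nbhs X)] -->
    (\matrix_(i, k) L (i, k) : 'M[C]_n.+1).
  by apply/cvg_mxP => i k; rewrite mxE; exact: hL (i, k).
by rewrite /extend (cvg_lim (@norm_hausdorff _ _) cL).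
Qed.

Lemma extend_unique (f : graded V) (L : 'M[C]_n.+1) :
  'valL_0 (f n) Y @[Y --> within (V n) (nbhs X)] --> L -> extend f X = L.
Proof. by move=> cL; rewrite /extend (cvg_lim (@norm_hausdorff _ _) cL). Qed.

(** A bound valid on [V] passes to the limit; the slack [t] pays for moving [f] and [p] from [X] to
    a nearby [Y]. *)
Lemma extend_poly_le (f : graded V) (p : freepoly R d) (e : R) : A_set f ->
  (forall (Y : V n) h, l2norm (mxact (f n Y - polyval p (\val Y)) h) <= e * l2norm h) ->
  forall h, l2norm (mxact (extend f X - polyval p X) h) <= e * l2norm h.
Proof.
move=> /extend_cvg/cvg_opnormP cf hf h.
apply: ler_addgt0_mul (l2norm_ge0 h) _ => t t0.
have t2 : 0 < t / 2 by rewrite divr_gt0.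
have near2 : \forall Y \near within (V n) (nbhs X), V n Y by exact: withinT.
have [Y [ [h1 h2] VY] ] := filter_ex (filterI (filterI (cf _ t2) (near_poly p t2)) near2).
rewrite (splitr t) addrCA; apply: opnorm_le_trans (h1 h) _.
rewrite (valL_in _ VY); apply: opnorm_le_trans (hf _ h) _; rewrite opnorm_sym.
exact: h2.
Qed.

Lemma extend_lin (a : C) (f g : graded V) : A_set f -> A_set g ->
  extend (a *: f + g) X = a *: extend f X + extend g X.
Proof.
move=> /extend_cvg/cvg_mxP cf /extend_cvg/cvg_mxP cg; apply: extend_unique.
rewrite (_ : 'valL_0 _ = fun Y => a *: 'valL_0 (f n) Y + 'valL_0 (g n) Y).
  apply/cvg_mxP => i k; rewrite !mxE; under eq_fun do rewrite !mxE.
  by apply: (cvgD _ (cg i k)); apply: cvgM (cf i k); exact: cvg_cst.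
(* Off [V] all three functions take the default value 0, so the identity holds there too. *)
apply/funext => Y; have [VY|VY] := pselect (V n Y); first by rewrite !(valL_in _ VY).
by rewrite !(valL_out _ VY) scaler0 addr0.
Qed.

Lemma extend_mul (f g : graded V) : A_set f -> A_set g ->
  extend (f * g) X = extend f X *m extend g X.
Proof.
move=> /extend_cvg cf /extend_cvg cg; apply: extend_unique.
rewrite (_ : 'valL_0 _ = fun Y => 'valL_0 (f n) Y *m 'valL_0 (g n) Y).
  by apply: cvg_mulmx cf cg.
apply/funext => Y; have [VY|VY] := pselect (V n Y); first by rewrite !(valL_in _ VY).
by rewrite !(valL_out _ VY) mulmx0.
Qed.

Lemma extend_one : extend (1 : graded V) X = 1.
Proof.
apply: extend_unique; apply/cvg_opnormP => e e0.
have near2 : \forall Y \near within (V n) (nbhs X), V n Y by exact: withinT.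
apply: filterS near2 => Y VY h; rewrite (valL_in _ VY) subrr mxact0 l2norm0.
by rewrite mulr_ge0 ?l2norm_ge0 // ltW.
Qed.

(** On [V] the block norms are at most the supremum, and this survives the limit; an infinite
    supremum leaves nothing to prove. *)
Lemma extend_block_le m (F : 'M[graded V]_m) : (forall j k, A_set (F j k)) ->
  (mxnorm (\mxblock_(j < m, k < m) extend (F j k) X) <= sup_mxnorm F)%E.
Proof.
move=> FA.
have s0 : (0%E <= sup_mxnorm F)%E by apply: ereal_sup_ubound; left.
have [->|sfin] := eqVneq (sup_mxnorm F) +oo%E; first by rewrite leey.
have fs : sup_mxnorm F \is a fin_num.
  by rewrite fin_numE sfin andbT gt_eqF //; apply: lt_le_trans s0; rewrite ltNyr.
pose c := fine (sup_mxnorm F).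
have c0 : 0 <= c by exact: fine_ge0.
have cE : sup_mxnorm F = c%:E by rewrite fineK.
rewrite cE; apply/mxnormP => // h.
pose M Y := \mxblock_(j < m, k < m) 'valL_0 (F j k n) Y.
have cM : M Y @[Y --> within (V n) (nbhs X)] --> \mxblock_(j < m, k < m) extend (F j k) X.
  apply/cvg_mxP => s t; rewrite mxE.
  under eq_fun do rewrite mxE.
  by have /extend_cvg/cvg_mxP := FA (tagnat.sig1 s) (tagnat.sig1 t); exact.
have hM Y : V n Y -> l2norm (mxact (M Y) h) <= c * l2norm h.
  move=> VY; move: h; apply/mxnormP => //; rewrite -cE.
  apply: ereal_sup_ubound; right; exists n, (elt_of VY); congr mxnorm.
  by apply/matrixP => s t; rewrite !mxE (valL_in _ VY).
apply: ler_addgt0_mul (l2norm_ge0 h) _ => t t0.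
have near2 : \forall Y \near within (V n) (nbhs X), V n Y by exact: withinT.
have /cvg_opnormP/(_ _ t0) near1 := cM.
have [Y [h1 /hM h2] ] := filter_ex (filterI near1 near2).
have := opnorm_le_trans (h1 h) (D := 0) (b := c); rewrite !subr0 addrC => /(_ h2).
exact.
Qed.

End Extension.

(** * Coordinates of a representation lie in the closure *)

Section Dilates.
Context {R : realType} {d : nat} {H K : hilbertType (Cplx R)}.
Local Notation C := (Cplx R).
Context {Q : 'I_d -> {linear H -> K}} {V : nc_set R d}.
Hypothesis Qcont : forall j, continuous (Q j).
Variables (Qfree : lin_indep Q) (Vsub : subvariety Q V).
Hypothesis Vhom : homogeneous V.
Arguments V : clear implicits.
Variables (n : nat) (Phi : rep_space V n).
Hypothesis Phicc : Rep_cc V n Phi.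
Local Notation X := (rep_pi V Qfree Vsub n Phi).

Lemma rep_pi_dilate (r : R) : 0 < r -> r < 1 ->
  V n (fun j => (r%:C%C ^+ 2) *: X j).
Proof.
move=> r0 r1; have [S SH VS] := Vsub.
have rn : rnorm ((r%:C%C : C) ^+ 2 : C^o) = r ^+ 2.
  by rewrite -rmorphXn rnorm_real // exprn_ge0 // ltW.
have XB : op_ball Q n (fun j => (r%:C%C ^+ 2) *: X j).
  apply/op_ballP; exists (r ^+ 2); split.
  - by rewrite exprn_ge0 // ltW.
  - by rewrite expr_lt1 // ltW.
  move=> h; rewrite (tensor_eval_scale Q X) l2normZ rn.
  by rewrite ler_wpM2l ?exprn_ge0 ?(ltW r0) // rep_pi_ball.
rewrite VS; exists (elt_of XB) => // f Sf.
apply: opnorm_small_eq0 => e e0.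
have e2 : 0 < e / 2 by rewrite divr_gt0.
have [p hp] := Hinf_dilation_approx Qcont (SH f Sf) r0 r1 e2.
(* As [r^2 Y] stays in [V], where [f] vanishes, [p] is at most [e/2] on [V]; contractivity of [Phi]
   carries this to [p(X)]. *)
have pX h : l2norm (mxact (polyval p X) h) <= e / 2 * l2norm h.
  rewrite -rep_poly_elt //; move: h; apply: rep_le => // [|l Y h]; first exact: ltW.
  have YB := subvariety_op_ball Vsub (set_mem (valP Y)).
  have rY : V l (fun j => (r%:C%C ^+ 2) *: \val Y j).
    apply: Vhom (set_mem (valP Y)).
    by rewrite -rnormE rn -[1]/(1%:C%C) lecR expr_le1 // ltW.
  have VE W : V l W -> exists2 Y' : op_ball Q l, forall f, S f -> f l Y' = 0 & \val Y' = W.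
    by rewrite VS => -[Y' hY' Y'E]; exists Y'.
  have [Y' hY' Y'E] := VE _ rY.
  have := hp l (\val Y) Y' _ _ h; rewrite hY' // sub0r -scaleN1r mxactZl l2normZ.
  rewrite val_poly_elt /rnorm normrN1 mul1r; apply=> [g|j]; last by rewrite Y'E.
  have /op_ballP[c [c0 c1 hc]] := YB.
  by apply: le_trans (hc g) _; rewrite ler_piMl ?l2norm_ge0 // ltW.
move=> h; rewrite -[f n _]subr0 (splitr e).
apply: opnorm_le_trans (hp n X _ _ _ h) _ => //; first exact: rep_pi_ball.
by rewrite subr0.
Qed.

Lemma rep_pi_closure : closure (V n) X.
Proof.
(* The radii increase to 1 and avoid 0, starting from 1/2 at [k = 0]. *)
pose r k : R := 1 - k.+2%:R^-1.
have r0 k : 0 < r k by rewrite subr_gt0 invf_lt1 // ltr1n.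
have r1 k : r k < 1 by rewrite ltrBlDr ltrDl invr_gt0.
pose Y k : mxtuple R d n := fun j => ((r k)%:C%C ^+ 2) *: X j.
have YX : Y k @[k --> \oo] --> X.
  apply: cvg_ptws => j; apply/cvg_mxP => i l.
  have rC : ((r k)%:C%C : C) @[k --> \oo] --> (1 : C).
    apply/(@cvg_rnormP _ C^o) => e e0.
    have /cvgrPdist_lt/(_ e e0) : (k.+1%:R^-1 : R) @[k --> \oo] --> 0.
      exact: cvg_harmonic.
    move=> [N _ hN]; exists N => // k Nk.
    have := hN k.+1 (leqW Nk); rewrite /= sub0r normrN ger0_norm ?invr_ge0 //.
    have -> : (1 : C) - (r k)%:C%C = (k.+2%:R^-1)%:C%C.
      by rewrite -(rmorph1 (real_complex R)) -rmorphB /r opprB addrCA subrr addr0.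
    by rewrite rnorm_real ?invr_ge0.
  rewrite -[X in _ --> X]mul1r -[1](expr1n _ 2).
  under eq_fun do rewrite mxE.
  apply: cvgM; last exact: cvg_cst.
  by rewrite expr1n -[1]mulr1; under eq_fun do rewrite expr2; exact: cvgM.
move=> B /YX [N _ hN]; exists (Y N); split; first exact: rep_pi_dilate.
exact: hN (leqnn N).
Qed.

End Dilates.

(** * Evaluation on the closure as the inverse map *)

Lemma extend_coord (R : realType) (d : nat) (V : nc_set R d) n (X : mxtuple R d n) j :
  closure (V n) X -> extend (coord_fun j : graded V) X = X j.
Proof.
move=> clX; apply: extend_unique => //; apply/cvg_opnormP => e e0.
have /cvg_opnormP/(_ _ e0) h := @coord_cvg R d n X j.
have VY : \forall Y \near within (V n) (nbhs X), V n Y by exact: withinT.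
have h' : \forall Y \near within (V n) (nbhs X),
    forall g, l2norm (mxact (X j - Y j) g) <= e * l2norm g by exact: cvg_within h.
by apply: filterS2 h' VY => Y hY VY g; rewrite (valL_in _ VY); exact: hY.
Qed.

(** Polynomial approximation is uniform on the closure as well, so [extend f] is a uniform limit of
    continuous functions there. *)
Lemma extend_continuous (R : realType) (d : nat) (V : nc_set R d) n (f : graded V) :
  A_set f -> {within closure (V n), continuous (fun X : mxtuple R d n => extend f X)}.
Proof.
move=> Af; apply/subspace_continuousP => X clX; apply/cvg_opnormP => e e0.
have e3 : 0 < e / 3 by rewrite divr_gt0.
have [_ _ /(_ _ e3)[p hp] ] := (A_setP f).1 Af.
have /cvg_opnormP/(_ _ e3) h := @polyval_cvg R d n p X.
have clY : \forall Y \near within (closure (V n)) (nbhs X), closure (V n) Y by exact: withinT.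
have h' : \forall Y \near within (closure (V n)) (nbhs X),
    forall g, l2norm (mxact (polyval p X - polyval p Y) g) <= e / 3 * l2norm g.
  exact: cvg_within h.
apply: filterS2 h' clY => Y hY cY g.
rewrite (_ : e = e / 3 + (e / 3 + e / 3)); last by field.
apply: opnorm_le_trans (extend_poly_le clX Af (hp n) g) _.
apply: opnorm_le_trans (hY g) _; rewrite opnorm_sym.
by have := extend_poly_le cY Af (hp n) g; exact.
Qed.

Theorem proposition5p3 (R : realType) (d : nat) (H K : hilbertType (Cplx R))
    (Q : 'I_d -> {linear H -> K}) (Qcont : forall j, continuous (Q j))
    (Qfree : lin_indep Q)
    (V : nc_set R d) (Vsub : subvariety Q V) (Vhom : homogeneous V) (n : nat) :
  homeomorphism (Rep_cc V n) (closure (V n))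
    (rep_pi V Qfree Vsub n) (Phi_at V n).
Proof.
have AP (a : A_alg V) : A_set (val a) by exact: set_mem (valP a).
split; first split.
- by move=> Phi Phicc; exact: rep_pi_closure.
(* Evaluation at [X] inherits all three properties as a limit of evaluations on [V]. *)
- move=> X clX; split.
  + by move=> a f g; exact: extend_lin.
  + by split=> [|f g]; [exact: extend_one|exact: extend_mul].
  + move=> m F; have := extend_block_le clX (F := map_mx val F).
    have -> : \mxblock_(j < m, k < m) extend (map_mx val F j k) X =
        \mxblock_(j < m, k < m) Phi_at V n X (F j k).
      by apply/matrixP => s t; rewrite !mxE.
    by apply => j k; rewrite mxE.
(* [Phi] and evaluation at its coordinates agree on polynomials, and each moves by at most [e/2]
   when [a] is replaced by a polynomial that close on [V]. *)
- move=> Phi /set_mem Phicc; apply/funext => a.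
  have clX : closure (V n) (rep_pi V Qfree Vsub n Phi) by exact: rep_pi_closure.
  set X := rep_pi V Qfree Vsub n Phi in clX *.
  apply/eqP; rewrite -subr_eq0; apply/eqP/opnorm_small_eq0 => e e0 h.
  have e2 : 0 < e / 2 by rewrite divr_gt0.
  have [_ _ /(_ _ e2)[p hp] ] := (A_setP _).1 (AP a).
  rewrite (splitr e); apply: opnorm_le_trans (extend_poly_le clX (AP a) (hp n) h) _.
  have [Phil _ _] := Phicc.
  rewrite -(rep_poly_elt Qfree Vsub Phicc) opnorm_sym -scaleN1r addrC -Phil.
  apply: rep_le => // [|l Y g]; first exact: ltW.
  rewrite -[val _ l Y]/(-1 *: val (poly_elt Qfree Vsub p) l Y + val a l Y).
  by rewrite val_poly_elt scaleN1r addrC; exact: hp.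
- move=> X /set_mem clX; apply/funext => j; exact: extend_coord.
split; apply/subspace_continuousP.
  (* [rep_pi] evaluates at the coordinate elements, hence is continuous for pointwise
     convergence. *)
  move=> Phi Phicc; apply: cvg_ptws => j.
  have h : (Psi (coord_elt V Qfree Vsub j) : 'M[Cplx R]_n.+1)
      @[Psi --> (Phi : rep_space V n)] --> Phi (coord_elt V Qfree Vsub j).
    exact: (@cvg_proj (A_alg V) 'M[Cplx R]_n.+1 Phi).
  by apply: cvg_trans h; apply: cvg_app; exact: cvg_within.
move=> X clX; apply: cvg_ptws => a.
exact: (subspace_continuousP _ _).1 (extend_continuous (n := n) (AP a)) X clX.
Qed.
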